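(* Let $n\ge 1$, $1<p<\infty$, let $R\subset\mathbb R^{n+1}$ be a parabolic rectangle, and let $0\le\gamma<1$, $\gamma<\alpha<1$ and $0<q\le1$. Assume that $f\in \mathrm{PBMO}^+_{\gamma,q}(R)$ and let $\|f\|=\|f\|_{\mathrm{PBMO}^+_{\gamma,q}(R)}$, with $\|f\|>0$. Then there exist a constant $c_R\in\mathbb R$ and positive constants $A$, $B$, depending only on $n,p,q,\gamma,\alpha$, such that \[ |R^{+}(\alpha)\cap\{(f-c_{R})_+>\lambda\}|\le A e^{-B(\lambda/\|f\|)^q}\,|R^{+}(\alpha)| \] and \[ |R^{-}(\alpha)\cap\{(f-c_{R})_->\lambda\}|\le A e^{-B(\lambda/\|f\|)^q}\,|R^{-}(\alpha)| \] for every $\lambda>0$.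
   Context: Points of $\mathbb R^{n+1}$ are written $(x,t)$ with $x\in\mathbb R^n$, $t\in\mathbb R$; $|E|$ is Lebesgue measure, integrals are with respect to $dx\,dt$, and $⨍_E g=\frac1{|E|}\int_E g$ denotes the integral average. Write $g_+=\max\{g,0\}$, $g_-=-\min\{g,0\}$. For $x\in\mathbb R^n$ and $L>0$ let $Q(x,L)=\{y\in\mathbb R^n:|y_i-x_i|\le L,\ i=1,\dots,n\}$. A parabolic rectangle (in the $p$-geometry, $1<p<\infty$ fixed) centered at $(x,t)$ with side length $L>0$ is $R=R(x,t,L)=Q(x,L)\times(t-L^p,t+L^p)$. For $-1<\gamma<1$ its upper and lower parts are $R^+(\gamma)=Q(x,L)\times(t+\gamma L^p,t+L^p)$ and $R^-(\gamma)=Q(x,L)\times(t-L^p,t-\gamma L^p)$. For a parabolic rectangle $R$, $0\le\gamma<1$ and $0<q<\infty$, a function $f\in L^q_{\mathrm{loc}}(R)$ belongs to $\mathrm{PBMO}^+_{\gamma,q}(R)$ if \[ \|f\|_{\mathrm{PBMO}^+_{\gamma,q}(R)}=\sup_{P\subset R}\ \inf_{c\in\mathbb R}\Big(⨍_{P^+(\gamma)}(f-c)_+^q+⨍_{P^-(\gamma)}(f-c)_-^q\Big)^{1/q}<\infty, \] where the supremum is over all parabolic rectangles $P\subset R$ (including $R$ itself). *)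

(* Defs.v *)
From HB Require Import structures.
From mathcomp Require Import all_boot all_order all_algebra.
From mathcomp Require Import all_classical all_reals all_analysis.
Import Order.TTheory GRing.Theory Num.Theory.
Import numFieldNormedType.Exports.

Set Implicit Arguments.
Unset Strict Implicit.
Unset Printing Implicit Defensive.

Local Open Scope classical_set_scope.
Local Open Scope ring_scope.

Notation spacetime R n := ('rV[R]_n * R)%type.

Section lebesgue.
Context (R : realType) (n : nat).
Implicit Types (a b : spacetime R n) (E : set (spacetime R n)).

Definition box a b : set (spacetime R n) :=
  [set z : spacetime R n | (forall i, a.1 0 i <= z.1 0 i <= b.1 0 i) /\ a.2 <= z.2 <= b.2].

(* The maxima make the volume 0 when the corners are not ordered, in which
   case the box is empty. *)
Definition box_volume a b : R :=
  (\prod_(i < n) Num.max 0 (b.1 0 i - a.1 0 i)) * Num.max 0 (b.2 - a.2).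

Definition box_cover E : set ((spacetime R n * spacetime R n)^nat) :=
  [set B | E `<=` \bigcup_k box (B k).1 (B k).2].

Definition lebesgue_outer E : \bar R :=
  ereal_inf [set (\sum_(k <oo) (box_volume (B k).1 (B k).2)%:E)%E
            | B in box_cover E].

Let volume_ge0 a b : (0 <= (box_volume a b)%:E)%E.
Proof.
rewrite lee_fin mulr_ge0 ?le_max ?lexx// prodr_ge0// => i _.
by rewrite le_max lexx.
Qed.

Let lebesgue_outer0 : lebesgue_outer set0 = 0%E.
Proof.
apply/eqP; rewrite eq_le; apply/andP; split; last first.
  by apply: le_ereal_inf_tmp => _ [B _ <-]; exact: nneseries_ge0.
apply: ereal_inf_lbound; exists (fun=> (point, point)) => //=.
by apply: eseries0 => k _ _; rewrite /box_volume subrr maxxx mulr0.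
Qed.

Let lebesgue_outer_ge0 E : (0 <= lebesgue_outer E)%E.
Proof. by apply: le_ereal_inf_tmp => _ [B _ <-]; exact: nneseries_ge0. Qed.

Let lebesgue_outer_subadditive E (F : (set (spacetime R n))^nat) :
  subset_sigma_subadditive lebesgue_outer E F.
Proof.
move=> EF; have [[i ioo]|] := pselect (exists i, lebesgue_outer (F i) = +oo%E).
  rewrite (eseries_pinfty _ _ ioo) ?leey// => k _.
  by rewrite -ltNye (lt_le_trans _ (lebesgue_outer_ge0 _)).
rewrite -forallNE => Foo.
apply/lee_addgt0Pr => _/posnumP[e].
rewrite (le_trans _ (epsilon_trick _ _ _))//.
pose vol (B : spacetime R n * spacetime R n) : \bar R :=
  (box_volume B.1 B.2)%:E.
have vol0 B : (0 <= vol B)%E by exact: volume_ge0.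
pose P k (B : (spacetime R n * spacetime R n)^nat) := box_cover (F k) B /\
  (\sum_(j <oo) vol (B j) <=
     lebesgue_outer (F k) + (e%:num / (2 ^ k.+1)%:R)%:E)%E.
have [G PG] : {G : nat -> (spacetime R n * spacetime R n)^nat
                 & forall k, P k (G k)}.
  apply: (@choice _ _ P) => k; rewrite /P.
  have fin : lebesgue_outer (F k) \is a fin_num.
    by rewrite ge0_fin_numE// ltey; apply/eqP; exact: Foo.
  have ek : 0 < e%:num / (2 ^ k.+1)%:R by rewrite divr_gt0// ltr0n expn_gt0.
  have [_ [B FB <-] lt] := lb_ereal_inf_adherent ek fin.
  by exists B; split => //; exact: ltW.
have G0 x : (0 <= (vol \o uncurry G) x)%E by exact: vol0.
apply: (@le_trans _ _ (\esum_(i in setT) (vol \o uncurry G) i)%E).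
  apply: ereal_inf_lbound => /=.
  have /card_esym/ppcard_eqP[f] := card_nat2.
  exists (uncurry G \o f).
    move=> t /EF[i _ Fit]; have [j _ Gijt] := (PG i).1 _ Fit.
    by exists (f^-1%FUN (i, j)) => //=; rewrite invK ?inE.
  rewrite -(esum_pred_image (vol \o uncurry G) _ xpredT) ?[fun=> _]set_true//.
  by rewrite image_eq.
rewrite (_ : esum _ _ = \sum_(i <oo) \sum_(j <oo) vol (G i j))%E; last first.
  pose J : nat -> set (nat * nat) := fun i => [set (i, j) | j in setT].
  rewrite (_ : setT = \bigcup_k J k); last first.
    by rewrite predeqE => -[a b]; split => // _; exists a => //; exists b.
  rewrite esum_bigcupT /=; last 2 first.
    - apply/trivIsetP => i j _ _ ij.
      rewrite predeqE => -[k m] /=; split => //= -[] [_] _ [<-{k} _].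
      by move=> [m' _] [] /esym/eqP; rewrite (negbTE ij).
    - by move=> x; exact: G0.
  rewrite -(image_id [set: nat]) -fun_true esum_pred_image//; last first.
    by move=> k _; apply: esum_ge0 => x _; exact: G0.
  apply: eq_eseriesr => /= j _.
  rewrite -(esum_pred_image (vol \o uncurry G) (pair j) predT)//=; last first.
    by move=> ? ? _ _; exact: (@can_inj _ _ _ snd).
  by congr esum; rewrite predeqE => -[a b]; split; move=> [i _ <-]; exists i.
apply: lee_nneseries => [k _|k _]; last exact: (PG k).2.
by move=> _; apply: nneseries_ge0 => j _ _; exact: vol0.
Qed.

HB.instance Definition _ := isSubsetOuterMeasure.Build R (spacetime R n)
  lebesgue_outer lebesgue_outer0 lebesgue_outer_ge0 lebesgue_outer_subadditive.

End lebesgue.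

(* Carries the sigma-algebra of all Lebesgue measurable sets, not only the
   Borel sets. *)
Notation lebesgue_space R n := (caratheodory_type (@lebesgue_outer R n)).

Section lebesgue_measure.
Context (R : realType) (n : nat).

Definition lebesgue : set (lebesgue_space R n) -> \bar R :=
  @lebesgue_outer R n.

Let lebesgue0 : lebesgue set0 = 0%E.
Proof. exact: caratheodory_measure0. Qed.

Let lebesgue_ge0 A : (0 <= lebesgue A)%E.
Proof. exact: caratheodory_measure_ge0. Qed.

Let lebesgue_sigma_additive : semi_sigma_additive lebesgue.
Proof. exact: caratheodory_measure_sigma_additive. Qed.

HB.instance Definition _ := isMeasure.Build _ _ _ lebesgue
  lebesgue0 lebesgue_ge0 lebesgue_sigma_additive.

End lebesgue_measure.
Arguments lebesgue {R n}.

Section parabolic.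
Context (R : realType) (n : nat).
Implicit Types (p q g L t c : R) (x : 'rV[R]_n) (f : spacetime R n -> R)
  (D : set (spacetime R n)).

Definition average (E : set (spacetime R n)) (h : spacetime R n -> R) : \bar R :=
  ((lebesgue E)^-1 * \int[lebesgue]_(z in E) (h z)%:E)%E.

Definition cube x L : set 'rV[R]_n := [set y | forall i, `|y 0 i - x 0 i| <= L].

Definition prect p x t L : set (spacetime R n) :=
  cube x L `*` `]t - L `^ p, t + L `^ p[.

Definition prect_up p g x t L : set (spacetime R n) :=
  cube x L `*` `]t + g * L `^ p, t + L `^ p[.

Definition prect_low p g x t L : set (spacetime R n) :=
  cube x L `*` `]t - L `^ p, t - g * L `^ p[.

(* A function on D is the restriction to D of a total f, whose values outside D
   are never used. *)
Definition locLq q D f : Prop :=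
  measurable_fun (D : set (lebesgue_space R n)) f /\
  forall K : set (spacetime R n), compact K -> K `<=` D ->
    lebesgue.-integrable K (fun z => (`|f z| `^ q)%:E).

Definition pbmo_osc p q g f x t L c : \bar R :=
  ((average (prect_up p g x t L)
      (fun z => ((f \- cst c)^\+ z) `^ q)%R
    + average (prect_low p g x t L)
      (fun z => ((f \- cst c)^\- z) `^ q)%R) `^ q^-1)%E.

Definition pbmo_norm p q g D f : \bar R :=
  ereal_sup [set r : \bar R | exists x t L,
    [/\ 0 < L, prect p x t L `<=` D &
        r = ereal_inf [set pbmo_osc p q g f x t L c | c in [set: R]]]].

Definition pbmo p q g D f : Prop :=
  locLq q D f /\ (pbmo_norm p q g D f < +oo)%E.

End parabolic.

(* Main.v *)
(* A John-Stroemberg argument.  By Chebyshev's inequality, every rectangle P in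
   the domain has a constant c_P such that f > c_P + K holds on a small
   proportion of P^+(gamma) only, and f < c_P - K on a small proportion of
   P^-(gamma) only.  If P^-(gamma) of a rectangle P' lies in P^+(gamma) of P and
   has comparable size, then c_P' <= c_P + 2K, as otherwise the two exceptional
   sets would cover P'^-(gamma).  Divide R^+(alpha) into nested cells U, each with
   a rectangle P_U having U in its upper part; since alpha > gamma, the rectangle
   of a child cell lies in the upper part of the rectangle of its parent.  Stop
   at the cells with c_{P_U} > c_R + 2K.  There c_{P_U} <= c_R + 4K by comparison
   with the parent, and f > c_R + K on most of P_U^-(gamma), so that a Vitali
   covering gives these cells at most half of the measure.  Almost everywhere
   outside of them f <= c_R + 3K.  Iterating in the stopped cells, each step
   raises the level by 4K and halves the measure.  The resulting bound
   exp(-B lambda / N) is stronger than the claim up to a constant, because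
   s^q <= 1 + s.

   Working with the outer measure of arbitrary sets, no measurability of f is
   needed after Chebyshev's inequality. *)

Require Import Defs.
From mathcomp Require Import all_boot all_order all_algebra.
From mathcomp Require Import all_classical all_reals all_analysis.
From mathcomp Require Import measurable_realfun ring lra.
Import Order.TTheory GRing.Theory Num.Theory.
Import numFieldNormedType.Exports.

Local Open Scope classical_set_scope.
Local Open Scope ring_scope.

Set Implicit Arguments.
Unset Strict Implicit.
Unset Printing Implicit Defensive.

(** * Lebesgue outer measure of boxes *)

(* The weights let one coordinate be integrated out at a time: its edge lengths
   are absorbed into [w] and [v]. *)
Lemma weighted_box_cover (R : realType) (m : nat) (A : nat -> set R) (l : nat -> R)
    (a b : nat -> nat -> R) (w : nat -> R) (v : R) :
  (forall i, measurable (A i)) ->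
  (forall i, lebesgue_measure (A i) = (l i)%:E) ->
  0 <= v -> (forall k, 0 <= w k) ->
  (forall y : nat -> R, (forall i, (i < m)%N -> A i (y i)) ->
    (v%:E <= \sum_(k <oo)
      (w k * \prod_(i < m) \1_(`[a k i, b k i]%classic) (y i))%:E)%E) ->
  ((v * \prod_(i < m) l i)%:E <=
   \sum_(k <oo) (w k * \prod_(i < m) Num.max 0 (b k i - a k i))%:E)%E.
Proof.
move=> mA lA; elim: m v w => [|m IH] v w v0 w0 cov.
  rewrite big_ord0 mulr1; apply: le_trans (cov (fun=> 0) _) _ => //.
  by apply: lee_nneseries => k _; rewrite ?big_ord0// mulr1 lee_fin.
have l0 i : 0 <= l i by rewrite -lee_fin -lA measure_ge0.
have max0 k i : 0 <= Num.max 0 (b k i - a k i) by rewrite le_max lexx.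
rewrite big_ord_recr /= mulrCA mulrC.
rewrite (_ : (fun k => _) = (fun k => (\sum_(0 <= j < k)
  ((w j * Num.max 0 (b j m - a j m)) *
    \prod_(i < m) Num.max 0 (b j i - a j i))%:E)%E)); last first.
  apply/funext => k; apply: eq_bigr => j _.
  by rewrite big_ord_recr /= mulrCA mulrC.
apply: IH => [|k|y Ay].
- by rewrite mulr_ge0.
- by rewrite mulr_ge0.
pose e k := w k * \prod_(i < m) \1_(`[a k i, b k i]%classic) (y i).
pose g k u : \bar R := ((e k)%:E * (\1_(`[a k m, b k m]%classic) u)%:E)%E.
have e0 k : 0 <= e k by rewrite mulr_ge0 ?prodr_ge0.
have g0 k u : (0 <= g k u)%E by rewrite /g -EFinM lee_fin mulr_ge0.
have mg k : measurable_fun (A m) (g k).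
  apply: measurable_funeM; apply/measurable_EFinP.
  exact/measurable_funTS/measurable_indic.
(* The covering inequality is integrated over the new coordinate [u] in [A m]. The left side gains
   the factor [l m], and each term gains at most the edge length [Num.max 0 (b k m - a k m)]. *)
rewrite EFinM -lA -integral_cst; last exact: mA.
apply: (@le_trans _ _ (\int[lebesgue_measure]_(u in A m) \sum_(k <oo) g k u)%E).
  apply: ge0_le_integral => //.
  - exact: mA.
  - by apply: (@ge0_emeasurable_sum _ _ _ (A m) g xpredT) => k *.
  - move=> u Au.
    apply: le_trans (cov (fun i => if i == m then u else y i) _) _.
      move=> i; rewrite ltnS leq_eqVlt => /orP[/eqP ->|im]; first by rewrite eqxx.
      by rewrite (ltn_eqF im); exact: Ay.
    apply: lee_nneseries => k _; first by rewrite lee_fin mulr_ge0 ?prodr_ge0.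
    rewrite big_ord_recr /= eqxx mulrA /g -EFinM lee_fin /e.
    by under eq_bigr => i _ do rewrite (ltn_eqF (ltn_ord i)).
rewrite integral_nneseries//; last exact: mA.
apply: lee_nneseries => [k _ _|k _].
  by apply: integral_ge0 => u _.
rewrite ge0_integralZl_EFin; last 4 first.
- exact: mA.
- by move=> u _; rewrite lee_fin.
- apply/measurable_EFinP; exact/measurable_funTS/measurable_indic.
- exact: e0.
rewrite integral_indic//; last exact: mA.
apply: (@le_trans _ _ ((e k)%:E * (Num.max 0 (b k m - a k m))%:E)%E).
  apply: lee_wpmul2l; first by rewrite lee_fin.
  apply: le_trans (measureIl _ _ _) _; [exact: measurable_itv|exact: mA|].
  rewrite [leLHS](lebesgue_measure_itv `[a k m, b k m]) /= lte_fin.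
  by case: ifPn => _; rewrite -?EFinD lee_fin le_max lexx ?orbT.
by rewrite -EFinM lee_fin /e mulrAC.
Qed.

Lemma lebesgue_measure_oo (R : realType) (a b : R) :
  lebesgue_measure (`]a, b[%classic : set R) = (Num.max 0 (b - a))%:E.
Proof.
rewrite (lebesgue_measure_itv `]a, b[) /= lte_fin -EFinD.
by case: ltP => ab; [rewrite max_r// subr_ge0 ltW|rewrite max_l// subr_le0].
Qed.

Section lebesgue_outer_boxes.
Context (R : realType) (n : nat).
Implicit Types (a b z : spacetime R n) (E H : set (spacetime R n)).
Local Notation mu := (@lebesgue_outer R n).

Lemma box_volume_ge0 a b : 0 <= box_volume a b.
Proof.
by rewrite mulr_ge0 ?le_max ?lexx// prodr_ge0// => i _; rewrite le_max lexx.
Qed.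

Lemma lebesgue_outer_cover_le E (B : nat -> spacetime R n * spacetime R n) :
  E `<=` \bigcup_k box (B k).1 (B k).2 ->
  (mu E <= \sum_(k <oo) (box_volume (B k).1 (B k).2)%:E)%E.
Proof. by move=> EB; apply: ereal_inf_lbound; exists B. Qed.

Lemma lebesgue_outer_box_le a b E : E `<=` box a b ->
  (mu E <= (box_volume a b)%:E)%E.
Proof.
move=> Eab.
have vol00 : box_volume (0 : spacetime R n) 0 = 0.
  by rewrite /box_volume /= subrr maxxx mulr0.
(* The sequence is padded with a single point; its time edge makes the volume 0 even when there is
   no space coordinate. *)
pose B k := if k is 0%N then (a, b) else (0, 0) : spacetime R n * spacetime R n.
apply: le_trans (@lebesgue_outer_cover_le E B _) _.
  by move=> z /Eab abz; exists 0%N.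
rewrite nneseries_recl//; last by move=> k _; rewrite lee_fin box_volume_ge0.
rewrite eseries_cond eseries0 ?adde0// => k _; case: k => [//|k _] /=.
by rewrite vol00.
Qed.

(** This is [weighted_box_cover] in n + 1 coordinates with all weights 1: each point of the product
    lies in some box of the cover, so the series of indicators is at least 1 there. *)
Lemma lebesgue_outer_prod_ge (A : 'I_n -> set R) (T : set R)
    (l : 'I_n -> R) (lT : R) E :
  (forall i, measurable (A i)) -> measurable T ->
  (forall i, lebesgue_measure (A i) = (l i)%:E) ->
  lebesgue_measure T = lT%:E ->
  (forall z, (forall i, A i (z.1 0 i)) -> T z.2 -> E z) ->
  ((\prod_(i < n) l i * lT)%:E <= mu E)%E.
Proof.
move=> mA mT lA lTE AE; apply: le_ereal_inf_tmp => _ [B EB <-].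
(* [ext] takes its default value at every index from n on, which turns time into coordinate n. *)
pose ext V (F : 'I_n -> V) (v : V) (i : nat) := oapp F v (insub i).
have extI V F (v : V) (i : 'I_n) : ext V F v i = F i by rewrite /ext valK.
have extn V F (v : V) : ext V F v n = v by rewrite /ext insubF// ltnn.
have := @weighted_box_cover R n.+1 (ext _ A T) (ext _ l lT)
  (fun k => ext _ ((B k).1.1 0) (B k).1.2)
  (fun k => ext _ ((B k).2.1 0) (B k).2.2) (fun=> 1) 1.
rewrite mul1r big_ord_recr /= extn.
under eq_bigr => i _ do rewrite extI.
move=> H.
apply: le_trans (H _ _ _ _ _) _ => //.
- by move=> i; rewrite /ext; case: insub.
- by move=> i; rewrite /ext; case: insub.
- move=> y Ay.
  have [|k _ [Bs Bt]] := EB (\row_(i < n) y i, y n).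
    apply: AE => /= [i|]; first by rewrite mxE -(extI _ A T); apply/Ay/ltnW/ltn_ord.
    by rewrite -(extn _ A T); exact: Ay.
  apply: le_trans (nneseries_lim_ge k.+1 _); last first.
    by move=> j _ _; rewrite lee_fin mul1r prodr_ge0.
  rewrite big_nat_recr//=; apply: le_trans (leeDr _ _); last first.
    by apply: sume_ge0 => j _; rewrite lee_fin mul1r prodr_ge0.
  rewrite lee_fin mul1r big_ord_recr /= !extn.
  rewrite big1 => [|i _]; first by rewrite mul1r indicE mem_set//= in_itv.
  rewrite !extI indicE mem_set//= in_itv/=.
  by have := Bs i; rewrite mxE.
- apply: lee_nneseries => [k _ _|k _].
    by rewrite lee_fin mul1r prodr_ge0// => i _; rewrite le_max lexx.
  rewrite lee_fin mul1r big_ord_recr /= !extn /box_volume.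
  by under eq_bigr => i _ do rewrite !extI.
Qed.

(** The open box already has the full volume by [lebesgue_outer_prod_ge], so it does not matter
    which faces [E] contains. *)
Lemma lebesgue_outer_boxE a b E :
  (forall z, (forall i, a.1 0 i < z.1 0 i < b.1 0 i) -> a.2 < z.2 < b.2 -> E z) ->
  E `<=` box a b -> mu E = (box_volume a b)%:E.
Proof.
move=> abE Eab; apply/eqP; rewrite eq_le lebesgue_outer_box_le//=.
apply: (@lebesgue_outer_prod_ge (fun i => `]a.1 0 i, b.1 0 i[%classic)
  `]a.2, b.2[%classic (fun i => Num.max 0 (b.1 0 i - a.1 0 i))
  (Num.max 0 (b.2 - a.2))) => [i||i||z Az Tz].
- exact: measurable_itv.
- exact: measurable_itv.
- exact: lebesgue_measure_oo.
- exact: lebesgue_measure_oo.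
- by apply: abE => [i|]; [have := Az i; rewrite /= in_itv|move: Tz; rewrite /= in_itv].
Qed.

(** Cutting every box of a cover of [X] yields covers of [X] inside and outside [H] whose volumes
    together do not exceed that of the original cover. *)
Lemma caratheodory_cut H :
  (forall a b, exists a1 b1 a2 b2, [/\ box a b `&` H `<=` box a1 b1,
     box a b `&` ~` H `<=` box a2 b2 &
     box_volume a1 b1 + box_volume a2 b2 <= box_volume a b]) ->
  mu.-caratheodory H.
Proof.
move=> cut; apply: le_caratheodory_measurable => X.
apply: le_ereal_inf_tmp => _ [B XB <-].
have /choice[C hC] : forall k, exists C : (spacetime R n * spacetime R n)
    * (spacetime R n * spacetime R n),
  [/\ box (B k).1 (B k).2 `&` H `<=` box C.1.1 C.1.2,
     box (B k).1 (B k).2 `&` ~` H `<=` box C.2.1 C.2.2 &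
     box_volume C.1.1 C.1.2 + box_volume C.2.1 C.2.2 <= box_volume (B k).1 (B k).2].
  move=> k; have [a1 [b1 [a2 [b2 ?]]]] := cut (B k).1 (B k).2.
  by exists ((a1, b1), (a2, b2)).
apply: (@le_trans _ _ (\sum_(k <oo) (box_volume (C k).1.1 (C k).1.2)%:E +
    \sum_(k <oo) (box_volume (C k).2.1 (C k).2.2)%:E)%E).
  apply: leeD.
    apply: (@lebesgue_outer_cover_le _ (fun k => (C k).1)) => z [/XB[k _ Bz] Hz].
    by exists k => //; have [+ _ _] := hC k; apply.
  apply: (@lebesgue_outer_cover_le _ (fun k => (C k).2)) => z [/XB[k _ Bz] Hz].
  by exists k => //; have [_ + _] := hC k; apply.
rewrite -nneseriesD; last 2 first.
- by move=> k _; rewrite lee_fin box_volume_ge0.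
- by move=> k _; rewrite lee_fin box_volume_ge0.
apply: lee_nneseries => [k _ _|k _].
  by rewrite -EFinD lee_fin addr_ge0 ?box_volume_ge0.
by rewrite -EFinD lee_fin; have [] := hC k.
Qed.

Let split_length (u v r : R) :
  Num.max 0 (Num.min v r - u) + Num.max 0 (v - Num.max u r) = Num.max 0 (v - u).
Proof.
by rewrite /Order.max /Order.min; do ! case: ifPn; rewrite -?leNgt => *; lra.
Qed.

Lemma caratheodory_time_cut H (r : R) :
  (forall z, z.2 < r -> H z) -> (forall z, H z -> z.2 <= r) ->
  mu.-caratheodory H.
Proof.
move=> ltH Hle; apply: caratheodory_cut => a b.
exists a, (b.1, Num.min b.2 r), (a.1, Num.max a.2 r), b; split.
- move=> z [[Hs /andP[az zb]] Hz]; split => //=.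
  by rewrite az le_min zb Hle.
- move=> z [[Hs /andP[az zb]] Hz]; split => //=.
  by rewrite ge_max zb az leNgt andbT; apply/negP => /ltH.
- by rewrite /box_volume /= -mulrDr split_length.
Qed.

Lemma caratheodory_space_cut H (j : 'I_n) (r : R) :
  (forall z, z.1 0 j < r -> H z) -> (forall z, H z -> z.1 0 j <= r) ->
  mu.-caratheodory H.
Proof.
move=> ltH Hle; apply: caratheodory_cut => a b.
exists a, (\row_i (if i == j then Num.min (b.1 0 i) r else b.1 0 i), b.2),
  (\row_i (if i == j then Num.max (a.1 0 i) r else a.1 0 i), a.2), b; split.
- move=> z [[Hs Ht] Hz]; split => //= i; have /andP[az zb] := Hs i.
  rewrite mxE; case: eqP => [->|_]; last by rewrite az zb.
  by have /andP[-> zb'] := Hs j; rewrite le_min zb' Hle.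
- move=> z [[Hs Ht] Hz]; split => //= i; have /andP[az zb] := Hs i.
  rewrite mxE; case: eqP => [->|_]; last by rewrite az zb.
  have /andP[az' ->] := Hs j; rewrite ge_max az' andbT leNgt.
  by apply/negP => /ltH.
- rewrite /box_volume /= -mulrDl.
  rewrite (bigD1 j)//= [X in _ + X](bigD1 j)//= [X in _ <= X * _](bigD1 j)//=.
  rewrite !mxE eqxx.
  under eq_bigr => i ij do rewrite mxE (negbTE ij).
  under [X in _ + _ * X]eq_bigr => i ij do rewrite mxE (negbTE ij).
  by rewrite -mulrDl split_length.
Qed.

End lebesgue_outer_boxes.

(** * Finite families of sets and Vitali selection *)

Section outer_measure_lists.
Context (R : realType) (T : Type) (mu : {outer_measure set T -> \bar R}).

(** The sets [A i] are split off one at a time by their Carathéodory identities, tested on [F],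
    which may be any set, such as a superlevel set of [f]. *)
Lemma outer_measure_sum_disjoint (I : eqType) (s : seq I) (A : I -> set T)
    (F X : set T) :
  uniq s -> (forall i, i \in s -> mu.-caratheodory (A i)) ->
  (forall i j z, i \in s -> j \in s -> A i z -> A j z -> i = j) ->
  (forall i, i \in s -> A i `<=` X) ->
  (\sum_(i <- s) mu (F `&` A i) <= mu (F `&` X))%E.
Proof.
elim: s X => [|i s IH] X /=; first by rewrite big_nil outer_measure_ge0.
move=> /andP[nis us] mA dA AX; rewrite big_cons.
have sS j : j \in s -> j \in i :: s by rewrite inE => ->; rewrite orbT.
rewrite (mA i (mem_head _ _) (F `&` X)); apply: leeD.
  apply: le_outer_measure => z [Fz Az]; split => //; split => //.
  exact: AX (mem_head _ _) _ Az.
rewrite -setIA; apply: IH => // [j /sS|j k z /sS js /sS|j js z Az].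
- exact: mA.
- exact: dA.
- split; first exact: AX (sS _ js) _ Az.
  move=> Aiz; move: nis; rewrite (dA i j z) ?mem_head ?js// sS//.
Qed.

Lemma outer_measure_le_sum (I : eqType) (s : seq I) (A : I -> set T) (E : set T) :
  (forall z, E z -> exists2 i, i \in s & A i z) ->
  (mu E <= \sum_(i <- s) mu (A i))%E.
Proof.
elim: s E => [|i s IH] E EA.
  rewrite big_nil (_ : E = set0) ?outer_measure0//.
  by apply/seteqP; split => // z /EA[].
rewrite big_cons; apply: le_trans (leeD (lexx _) (IH (E `\` A i) _)).
  apply: le_trans (outer_measureU2 _ _ _); apply: le_outer_measure => z Ez.
  by have [Az|nAz] := pselect (A i z); [left|right].
move=> z [/EA[j]]; rewrite inE => /orP[/eqP->//|js Az _].
by exists j.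
Qed.

End outer_measure_lists.

(** Vitali selection: the indices are visited in order of decreasing [r], and one is kept when its
    set meets none of those kept so far. A rejected set therefore meets a kept one of at least its
    size. *)
Lemma greedy_disjoint_subfamily (R : realType) (I : eqType) (T : Type)
    (s : seq I) (r : I -> R) (A : I -> set T) :
  (forall i, i \in s -> A i !=set0) ->
  exists t : seq I, [/\ uniq t, {subset t <= s},
    (forall i j z, i \in t -> j \in t -> A i z -> A j z -> i = j) &
    (forall i, i \in s -> exists2 j, j \in t & r i <= r j /\ A i `&` A j !=set0)].
Proof.
move=> A0.
pose ge i j := r j <= r i.
have tot : total ge by move=> i j; exact: le_total.
have tr : transitive ge by move=> i j k ij jk; exact: le_trans jk ij.
suff : forall s', pairwise ge s' -> {subset s' <= s} ->
  exists t : seq I, [/\ uniq t, {subset t <= s'},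
    (forall i j z, i \in t -> j \in t -> A i z -> A j z -> i = j) &
    (forall i, i \in s' -> exists2 j, j \in t & r i <= r j /\ A i `&` A j !=set0)].
  move=> /(_ (sort ge s)); case.
  - by rewrite -sorted_pairwise// sort_sorted.
  - by move=> i; rewrite mem_sort.
  move=> t [ut ts dt ht]; exists t; split => // [i /ts|i si].
    by rewrite mem_sort.
  by apply: ht; rewrite mem_sort.
(* The list decreases in [r], so the appended [v] has the smallest value and can only be dominated
   by indices already kept. *)
elim/last_ind => [|s' v IH]; first by exists [::]; split.
rewrite pairwise_rcons => /andP[/allP gev ps'] s's.
have [||t [ut ts dt ht]] := IH => //.
  by move=> i si; apply: s's; rewrite mem_rcons inE si orbT.
have vs : v \in s by apply: s's; rewrite mem_rcons mem_head.
have [meet|nmeet] := pselect (exists2 j, j \in t & A v `&` A j !=set0).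
  exists t; split => // [i /ts|i]; rewrite mem_rcons inE.
    by move=> ->; rewrite orbT.
  move=> /orP[/eqP ->|/ht//].
  by have [j jt Avj] := meet; exists j => //; split => //; exact/gev/ts.
exists (v :: t); split.
- rewrite /= ut andbT; apply/negP => vt; apply: nmeet; exists v => //.
  by rewrite setIid; exact: A0.
- move=> i; rewrite mem_rcons !inE => /orP[->//|/ts ->]; exact: orbT.
- move=> i j z; rewrite !inE => /orP[/eqP ->|it] /orP[/eqP ->|jt] // Ai Aj.
  + by exfalso; apply: nmeet; exists j => //; exists z.
  + by exfalso; apply: nmeet; exists i => //; exists z.
  + exact: dt Ai Aj.
- move=> i; rewrite mem_rcons inE => /orP[/eqP ->|/ht[j jt hj]].
    exists v; first exact: mem_head.
    by rewrite setIid; split => //; exact: A0.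
  by exists j => //; rewrite inE jt orbT.
Qed.

(** * Tubes: measure and Carathéodory measurability *)

Section tubes.
Context (R : realType) (n : nat).
Implicit Types (x : 'rV[R]_n) (l a b : R).
Local Notation mu := (@lebesgue_outer R n).

(** Closed in space and open in time, like parabolic rectangles and their parts. *)
Definition tube x l a b : set (spacetime R n) :=
  [set z : spacetime R n | (forall i, `|z.1 0 i - x 0 i| <= l) /\ a < z.2 < b].

(** Half open in every coordinate, so that subdivisions tile exactly. *)
Definition half_open_tube x l a b : set (spacetime R n) :=
  [set z : spacetime R n | (forall i, x 0 i - l <= z.1 0 i < x 0 i + l) /\ a <= z.2 < b].

Lemma lebesgue_outer_tube x l a b (E : set (spacetime R n)) : 0 <= l -> a <= b ->
  (forall z : spacetime R n, (forall i, `|z.1 0 i - x 0 i| < l) -> a < z.2 < b -> E z) ->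
  (forall z, E z -> (forall i, `|z.1 0 i - x 0 i| <= l) /\ a <= z.2 <= b) ->
  mu E = ((2 * l) ^+ n * (b - a))%:E.
Proof.
move=> l0 ab oE Ec.
rewrite (@lebesgue_outer_boxE _ _ (\row_i (x 0 i - l), a) (\row_i (x 0 i + l), b)) /=.
- rewrite /box_volume /= max_r ?subr_ge0//; congr (_ * _)%:E.
  rewrite (eq_bigr (fun=> 2 * l)) ?prodr_const ?card_ord// => i _.
  by rewrite !mxE max_r; lra.
- move=> z zx zt; apply: oE => // i; have := zx i.
  by rewrite !mxE ltr_distl.
- move=> z /Ec[zx zt]; split => // i; have := zx i.
  by rewrite !mxE ler_distl.
Qed.

Lemma lebesgue_tube x l a b : 0 <= l -> a <= b ->
  mu (tube x l a b) = ((2 * l) ^+ n * (b - a))%:E.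
Proof.
move=> l0 ab; apply: (@lebesgue_outer_tube x) => // z.
  by move=> zx zt; split => // i; rewrite ltW.
by move=> [zx /andP[az zb]]; rewrite !ltW.
Qed.

Lemma lebesgue_half_open_tube x l a b : 0 <= l -> a <= b ->
  mu (half_open_tube x l a b) = ((2 * l) ^+ n * (b - a))%:E.
Proof.
move=> l0 ab; apply: (@lebesgue_outer_tube x) => // z.
  move=> zx /andP[az zb]; split=> [i|]; last by rewrite (ltW az).
  by have := zx i; rewrite ltr_distl => /andP[/ltW -> ->].
move=> [zx /andP[az zb]]; rewrite az ltW//; split => // i.
by have /andP[zl zr] := zx i; rewrite ler_distl zl ltW.
Qed.

Lemma caratheodory_space (P : 'I_n -> set R) (Q : set R) :
  (forall i, mu.-caratheodory [set z : spacetime R n | P i (z.1 0 i)]) ->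
  mu.-caratheodory [set z : spacetime R n | Q z.2] ->
  mu.-caratheodory [set z : spacetime R n | (forall i, P i (z.1 0 i)) /\ Q z.2].
Proof.
move=> mP mQ; apply: (@caratheodory_measurable_setI _ _ _ _
  [set z : spacetime R n | Q z.2]) => //.
suff : forall s : seq 'I_n, mu.-caratheodory
    [set z : spacetime R n | forall i, i \in s -> P i (z.1 0 i)].
  move=> /(_ (enum 'I_n)); congr (mu.-caratheodory _).
  by apply/seteqP; split => z /= h i => [|_]; apply: h; rewrite mem_enum.
elim=> [|j s IH].
  have -> : [set z : spacetime R n | forall i, i \in [::] -> P i (z.1 0 i)] = ~` set0.
    by apply/seteqP; split => // z _ i.
  exact/caratheodory_measurable_setC/caratheodory_measurable_set0.
rewrite (_ : [set z | _] = [set z : spacetime R n | P j (z.1 0 j)] `&`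
    [set z : spacetime R n | forall i, i \in s -> P i (z.1 0 i)]).
  exact: caratheodory_measurable_setI.
apply/seteqP; split => z /=.
  move=> h; split; first by apply: h; exact: mem_head.
  by move=> i si; apply: h; rewrite inE si orbT.
by move=> [hj hs] i; rewrite inE => /orP[/eqP ->//|/hs].
Qed.

Lemma caratheodory_coordinate_itv (i : 'I_n) (b1 b2 : bool) (u v : R) :
  mu.-caratheodory
    [set z : spacetime R n | z.1 0 i \in Interval (BSide b1 u) (BSide b2 v)].
Proof.
have -> : [set z : spacetime R n | z.1 0 i \in Interval (BSide b1 u) (BSide b2 v)]
  = ~` [set z : spacetime R n | ~~ (u < z.1 0 i ?<= if b1)] `&`
    [set z : spacetime R n | z.1 0 i < v ?<= if ~~ b2].
  apply/seteqP; split => z; rewrite /= itv_boundlr /=.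
    by move=> /andP[h1 h2]; split; [move=> /negP; apply; case: b1 h1|case: b2 h2].
  by move=> [/negP/negbNE h1 h2]; apply/andP; split; [case: b1 h1|case: b2 h2].
apply: caratheodory_measurable_setI; first apply: caratheodory_measurable_setC.
  apply: (@caratheodory_space_cut _ _ _ i u) => z /=.
    by move=> zu; case: b1; rewrite /= -?ltNge -?leNgt ?ltW.
  by case: b1; rewrite /= -?ltNge -?leNgt// => /ltW.
apply: (@caratheodory_space_cut _ _ _ i v) => z /=.
  by move=> zu; case: b2; rewrite /= ?ltW.
by case: b2 => //= /ltW.
Qed.

Lemma caratheodory_time_itv (b1 b2 : bool) (u v : R) :
  mu.-caratheodory
    [set z : spacetime R n | z.2 \in Interval (BSide b1 u) (BSide b2 v)].
Proof.
have -> : [set z : spacetime R n | z.2 \in Interval (BSide b1 u) (BSide b2 v)]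
  = ~` [set z : spacetime R n | ~~ (u < z.2 ?<= if b1)] `&`
    [set z : spacetime R n | z.2 < v ?<= if ~~ b2].
  apply/seteqP; split => z; rewrite /= itv_boundlr /=.
    by move=> /andP[h1 h2]; split; [move=> /negP; apply; case: b1 h1|case: b2 h2].
  by move=> [/negP/negbNE h1 h2]; apply/andP; split; [case: b1 h1|case: b2 h2].
apply: caratheodory_measurable_setI; first apply: caratheodory_measurable_setC.
  apply: (@caratheodory_time_cut _ _ _ u) => z /=.
    by move=> zu; case: b1; rewrite /= -?ltNge -?leNgt ?ltW.
  by case: b1; rewrite /= -?ltNge -?leNgt// => /ltW.
apply: (@caratheodory_time_cut _ _ _ v) => z /=.
  by move=> zu; case: b2; rewrite /= ?ltW.
by case: b2 => //= /ltW.
Qed.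

Lemma caratheodory_tube x l a b : mu.-caratheodory (tube x l a b).
Proof.
rewrite (_ : tube x l a b = [set z : spacetime R n |
    (forall i, z.1 0 i \in `[x 0 i - l, x 0 i + l]) /\ z.2 \in `]a, b[]).
  apply: (@caratheodory_space (fun i => [set y | y \in `[x 0 i - l, x 0 i + l]])
    [set u | u \in `]a, b[]) => [i|].
    exact: caratheodory_coordinate_itv.
  exact: caratheodory_time_itv.
by apply/seteqP; split => z /= [zx zt]; (split; [move=> i; have := zx i|move: zt];
  rewrite in_itv /= ?ler_distl).
Qed.

Lemma caratheodory_half_open_tube x l a b :
  mu.-caratheodory (half_open_tube x l a b).
Proof.
rewrite (_ : half_open_tube x l a b = [set z : spacetime R n |
    (forall i, z.1 0 i \in `[x 0 i - l, x 0 i + l[) /\ z.2 \in `[a, b[]).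
  apply: (@caratheodory_space (fun i => [set y | y \in `[x 0 i - l, x 0 i + l[])
    [set u | u \in `[a, b[]) => [i|].
    exact: caratheodory_coordinate_itv.
  exact: caratheodory_time_itv.
by apply/seteqP; split => z /= [zx zt]; (split; [move=> i; have := zx i|move: zt];
  rewrite in_itv).
Qed.

End tubes.

(** * Uniform subdivision of an interval *)

Lemma uniform_grid (R : realType) (u w y : R) (N : nat) : 0 < w ->
  u <= y < u + N%:R * w ->
  exists k : 'I_N, u + k%:R * w <= y < u + k.+1%:R * w.
Proof.
move=> w0 /andP[uy yu].
have q0 : 0 <= (y - u) / w by rewrite divr_ge0 ?subr_ge0// ltW.
have /andP[le lt] := truncn_itv q0.
have kN : (Num.truncn ((y - u) / w) < N)%N.
  rewrite -(ltr_nat R) (le_lt_trans le)// ltr_pdivrMr//; lra.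
exists (Ordinal kN) => /=.
by move: le lt; rewrite ler_pdivlMr// ltr_pdivrMr// => le lt; apply/andP; split; lra.
Qed.

Lemma uniform_grid_inj (R : realType) (u w y : R) (j k : nat) : 0 < w ->
  u + j%:R * w <= y < u + j.+1%:R * w -> u + k%:R * w <= y < u + k.+1%:R * w ->
  j = k.
Proof.
move=> w0 /andP[a b] /andP[c d].
have : j%:R * w < k.+1%:R * w by lra.
have : k%:R * w < j.+1%:R * w by lra.
rewrite !ltr_pM2r// !ltr_nat !ltnS => kj jk.
by apply/eqP; rewrite eqn_leq jk kj.
Qed.

(** * Space-time cells and the stopping argument *)

Definition cell (R : realType) (n : nat) := ('rV[R]_n * R * R * R)%type.

Section cells.
Context (R : realType) (n : nat) (p gamma alpha : R) (N : nat).
Hypotheses (p1 : 1 < p) (gamma_ge0 : 0 <= gamma) (gamma_alpha : gamma < alpha)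
  (alpha_lt1 : alpha < 1) (N_large : 2 <= (alpha - gamma) * N%:R).
Implicit Types (u v : cell R n) (z : spacetime R n).
Local Notation mu := (@lebesgue_outer R n).

Definition center u : 'rV[R]_n := u.1.1.1.
Definition top u : R := u.1.1.2.
Definition side u : R := u.1.2.
Definition height u : R := u.2.

(** The cell and its rectangle [whole u] share their spatial extent, with [side] as half width, and
    their final time. *)
Definition cell_set u :=
  half_open_tube (center u) (side u) (top u - height u) (top u).
Definition whole u := tube (center u) (side u) (top u - 2 * side u `^ p) (top u).
Definition upper u :=
  tube (center u) (side u) (top u - (1 - gamma) * side u `^ p) (top u).
Definition lower u := tube (center u) (side u)
  (top u - 2 * side u `^ p) (top u - (1 + gamma) * side u `^ p).

Definition valid_cell u := [/\ 0 < side u,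
  (1 - alpha) * side u `^ p <= 2 * height u &
  height u <= (1 - alpha) * side u `^ p].

(* [N ^ p] need not be an integer, so the height of a cell is only kept between
   one half and one times [(1 - alpha) * side ^ p]. *)
Definition slices u : nat :=
  (Num.truncn (height u / ((1 - alpha) * (side u / N%:R) `^ p))).+1.

(** The subintervals have half width [side u / N], so their midpoints sit at odd multiples of it.
    The successor of [j] appears because the final time of the slice is stored. *)
Definition child u (k : {ffun 'I_n -> 'I_N}) (j : nat) : cell R n :=
  (\row_i (center u 0 i - side u + (2 * (k i)%:R + 1) * (side u / N%:R)),
   top u - height u + j.+1%:R * (height u / (slices u)%:R),
   side u / N%:R, height u / (slices u)%:R).

Definition children u : seq (cell R n) :=
  [seq child u k.1 k.2 | k : {ffun 'I_n -> 'I_N} * 'I_(slices u)].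

Let N_ge2 : 2 <= N%:R :> R.
Proof.
apply: le_trans N_large _; rewrite -[leRHS]mul1r ler_wpM2r//.
by move: gamma_ge0 alpha_lt1; lra.
Qed.

Let N_gt0 : 0 < N%:R :> R. Proof. by have := N_ge2; lra. Qed.

Let Q : R := N%:R `^ p.

Let Q_geN : N%:R <= Q.
Proof. by rewrite /Q -[leLHS]powRr1 ?ler_powR//; [have := N_ge2; lra|exact: ltW]. Qed.

Lemma side_powR u : 0 < side u -> side u `^ p = (side u / N%:R) `^ p * N%:R `^ p.
Proof.
move=> u0; rewrite -powRM ?ler0n ?divfK ?gt_eqF//.
by rewrite divr_ge0 ?ler0n ?ltW.
Qed.

(** Put d = (1 - alpha) * (side u / N) ^ p. Since N ^ p >= 2, the height h of [u] is at least d, so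
    the floor of h / d is at least 1 and passing to its successor at most doubles it; hence the
    slices have height between d / 2 and d. *)
Lemma slicesP u : valid_cell u ->
  height u / (slices u)%:R <= (1 - alpha) * (side u / N%:R) `^ p /\
  (1 - alpha) * (side u / N%:R) `^ p <= 2 * (height u / (slices u)%:R).
Proof.
move: gamma_ge0 gamma_alpha alpha_lt1 => g0 ga a1.
move=> [u0 hl hu]; rewrite /slices; move: hl hu; rewrite (side_powR u0).
have : 0 < (side u / N%:R) `^ p by apply/powR_gt0/divr_gt0.
move: Q_geN N_ge2; rewrite /Q.
move: ((side u / N%:R) `^ p) (N%:R `^ p) => e q qN N2 e0 hl hu.
set d := (1 - alpha) * e.
have d0 : 0 < d by rewrite mulr_gt0// subr_gt0.
have dh : d <= height u.
  have : d * 2 <= d * q by rewrite ler_wpM2l//; [exact: ltW|lra].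
  by move: hl; rewrite mulrA -/d; lra.
have y0 : 0 <= height u / d by rewrite divr_ge0//; lra.
have /andP[le lt] := truncn_itv y0.
move: le lt; rewrite ler_pdivlMr// ltr_pdivrMr//.
set m := Num.truncn _ => le lt.
have m0 : 0 < m.+1%:R :> R by rewrite ltr0n.
split; first by rewrite ler_pdivrMr//; lra.
rewrite mulrA ler_pdivlMr//.
rewrite -natr1; move: le; rewrite mulrC; lra.
Qed.

Let height_gt0 u : valid_cell u -> 0 < height u.
Proof.
move: gamma_ge0 gamma_alpha alpha_lt1 => g0 ga a1.
move=> [u0 hl hu].
have : 0 < (1 - alpha) * side u `^ p by rewrite mulr_gt0 ?powR_gt0// subr_gt0.
lra.
Qed.

Let slices_gt0 u : 0 < (slices u)%:R :> R.
Proof. by rewrite ltr0n. Qed.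

Lemma child_valid u k j : valid_cell u -> valid_cell (child u k j).
Proof.
move: gamma_ge0 gamma_alpha alpha_lt1 => g0 ga a1.
move=> vu; have [u0 _ _] := vu; have [h1 h2] := slicesP vu.
by split; rewrite /child /side /height //= divr_gt0.
Qed.

Lemma childrenP u v : reflect
  (exists k (j : 'I_(slices u)), v = child u k j) (v \in children u).
Proof.
apply: (iffP mapP) => [[[k j] _ ->]|[k [j ->]]]; first by exists k, j.
by exists (k, j) => //; rewrite mem_enum.
Qed.

Lemma child_cell_setP u (k : {ffun 'I_n -> 'I_N}) j z : cell_set (child u k j) z <->
  (forall i, center u 0 i - side u + (k i)%:R * (2 * (side u / N%:R)) <= z.1 0 i
     < center u 0 i - side u + (k i).+1%:R * (2 * (side u / N%:R))) /\
  top u - height u + j%:R * (height u / (slices u)%:R) <= z.2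
    < top u - height u + j.+1%:R * (height u / (slices u)%:R).
Proof.
rewrite /cell_set /half_open_tube /child /center /side /top /height /=.
by split=> -[zx zt]; (split=> [i|]; [have := zx i; rewrite !mxE|move: zt]);
  rewrite -natr1 => /andP[? ?]; apply/andP; split; lra.
Qed.

Lemma cell_set_child u z : valid_cell u -> cell_set u z ->
  exists2 v, v \in children u & cell_set v z.
Proof.
move: gamma_ge0 gamma_alpha alpha_lt1 => g0 ga a1.
move=> vu [zx zt]; have [u0 _ _] := vu; have h0 := height_gt0 vu.
have /choice[k hk] : forall i, exists k : 'I_N,
    center u 0 i - side u + k%:R * (2 * (side u / N%:R)) <= z.1 0 i
     < center u 0 i - side u + k.+1%:R * (2 * (side u / N%:R)).
  move=> i; apply: uniform_grid; first by rewrite mulr_gt0// divr_gt0.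
  rewrite [N%:R * _]mulrCA [N%:R * _]mulrCA divff ?gt_eqF// mulr1.
  by have /andP[? ?] := zx i; apply/andP; split; lra.
have [|j hj] := @uniform_grid R (top u - height u) (height u / (slices u)%:R)
    z.2 (slices u) (divr_gt0 h0 (slices_gt0 u)).
  by rewrite mulrCA divff ?gt_eqF// mulr1 subrK.
exists (child u (finfun k) j); first by apply/childrenP; exists (finfun k), j.
by apply/child_cell_setP; split=> // i; rewrite ffunE.
Qed.

Lemma child_cell_set_sub u k (j : 'I_(slices u)) : valid_cell u ->
  cell_set (child u k j) `<=` cell_set u.
Proof.
move: gamma_ge0 gamma_alpha alpha_lt1 => g0 ga a1.
move=> vu z /child_cell_setP[zx zt]; have [u0 _ _] := vu; have h0 := height_gt0 vu.
have grid (w : R) (m k' : nat) : 0 < m%:R :> R -> 0 < w -> (k' < m)%N ->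
    0 <= k'%:R * (w / m%:R) /\ k'.+1%:R * (w / m%:R) <= w.
  move=> m0 w0 km; split; first by rewrite mulr_ge0// divr_ge0 ?ltW.
  by rewrite mulrCA ger_pMr// ler_pdivrMr// mul1r ler_nat.
split => [i|].
  have [] := grid (2 * side u) N (k i) N_gt0 _ (ltn_ord _); first by rewrite mulr_gt0.
  have /andP[] := zx i; rewrite !mulrA => ? ? ? ?; apply/andP; split; lra.
have [] := grid (height u) (slices u) j (slices_gt0 u) h0 (ltn_ord _).
by move: zt => /andP[? ?] ? ?; apply/andP; split; lra.
Qed.

Lemma caratheodory_cell_set u : mu.-caratheodory (cell_set u).
Proof. exact: caratheodory_half_open_tube. Qed.

Lemma sum_children_le u (F : set (spacetime R n)) : valid_cell u ->
  (\sum_(v <- children u) mu (F `&` cell_set v) <= mu (F `&` cell_set u))%E.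
Proof.
move=> vu; have [u0 _ _] := vu; have h0 := height_gt0 vu.
rewrite big_map; apply: outer_measure_sum_disjoint; first exact: enum_uniq.
- by move=> i _; exact: caratheodory_cell_set.
- move=> [k j] [k' j'] z _ _ /child_cell_setP[/= kz jz] /child_cell_setP[/= kz' jz'].
  have w0 : 0 < 2 * (side u / N%:R) by rewrite mulr_gt0// divr_gt0.
  congr pair.
    by apply/ffunP => i; apply/val_inj/(uniform_grid_inj w0 (kz i) (kz' i)).
  exact/val_inj/(uniform_grid_inj (divr_gt0 h0 (slices_gt0 u)) jz jz').
- by move=> [k j] _; exact: child_cell_set_sub.
Qed.

(** The final time of [v] lies less than (1 - alpha) * side u ^ p before that of [u], and its
    rectangle reaches back by 2 * (side u / N) ^ p. By [N_large] and N <= N ^ p this is at most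
    (alpha - gamma) * side u ^ p, for a total of (1 - gamma) * side u ^ p. *)
Lemma whole_child_sub u v : valid_cell u -> v \in children u ->
  whole v `<=` upper u.
Proof.
move: gamma_ge0 gamma_alpha alpha_lt1 => g0 ga a1.
move=> vu /childrenP[k [j ->]] z [zx zt].
have [u0 hl hu] := vu; have h0 := height_gt0 vu.
have lu0 : 0 < side u / N%:R by rewrite divr_gt0.
split => [i|].
  have := zx i; rewrite (_ : side (child _ _ _) = side u / N%:R)// mxE -/(center u).
  rewrite !ler_distl.
  set m : R := (k i)%:R => /andP[zl zr].
  have mN : m + 1 <= N%:R by rewrite natr1 ler_nat.
  have le1 : (m + 1) * (side u / N%:R) <= side u.
    by rewrite mulrCA ger_pMr// ler_pdivrMr// mul1r.
  have le0 : 0 <= m * (side u / N%:R) by rewrite mulr_ge0// ltW.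
  by apply/andP; split; lra.
have := zt; rewrite (_ : side (child _ _ _) = side u / N%:R)//.
rewrite (_ : top (child _ _ _) =
  top u - height u + j.+1%:R * (height u / (slices u)%:R))//.
have s1 : j.+1%:R * (height u / (slices u)%:R) <= height u.
  by rewrite mulrCA ger_pMr// ler_pdivrMr// mul1r ler_nat.
have s0 : 0 < j.+1%:R * (height u / (slices u)%:R).
  by rewrite mulr_gt0// ?ltr0n// divr_gt0.
have e0 : 0 < (side u / N%:R) `^ p by rewrite powR_gt0.
have e2 : 2 * (side u / N%:R) `^ p <= (alpha - gamma) * side u `^ p.
  rewrite (side_powR u0) mulrCA mulrC ler_wpM2l ?(ltW e0)//.
  by apply: le_trans N_large _; rewrite ler_wpM2l// subr_ge0 ltW.
by move=> /andP[? ?]; apply/andP; split; lra.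
Qed.

Lemma upper_sub_whole u : 0 < side u -> upper u `<=` whole u.
Proof.
move: gamma_ge0 gamma_alpha alpha_lt1 => g0 ga a1.
move=> u0 z [zx /andP[zt1 zt2]]; split => //.
have e0 : 0 < side u `^ p by rewrite powR_gt0.
have : 0 <= gamma * side u `^ p by rewrite mulr_ge0// ltW.
by rewrite zt2 andbT; lra.
Qed.

Lemma lower_sub_whole u : 0 < side u -> lower u `<=` whole u.
Proof.
move: gamma_ge0 gamma_alpha alpha_lt1 => g0 ga a1.
move=> u0 z [zx /andP[zt1 zt2]]; split => //.
have e0 : 0 < side u `^ p by rewrite powR_gt0.
have : 0 <= gamma * side u `^ p by rewrite mulr_ge0// ltW.
by rewrite zt1/=; lra.
Qed.

Lemma cell_set_sub_upper u : valid_cell u -> cell_set u `<=` upper u.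
Proof.
move: gamma_ge0 gamma_alpha alpha_lt1 => g0 ga a1.
move=> [u0 _ hu] z [zx /andP[zt1 zt2]]; split => [i|].
  by have /andP[zl zr] := zx i; rewrite ler_distl zl ltW.
have : (1 - alpha) * side u `^ p < (1 - gamma) * side u `^ p.
  by rewrite ltr_pM2r ?powR_gt0//; lra.
by rewrite zt2 andbT; lra.
Qed.

(** Half the measure of [whole u]. For a valid cell, the measure of [cell_set u] lies between (1 -
    alpha) / 2 and 1 - alpha times this quantity. *)
Definition cell_measure u := (2 * side u) ^+ n * side u `^ p.

Lemma cell_measure_gt0 u : 0 < side u -> 0 < cell_measure u.
Proof. by move=> u0; rewrite mulr_gt0 ?powR_gt0// exprn_gt0// mulr_gt0. Qed.

Lemma lebesgue_cell_set u : valid_cell u ->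
  mu (cell_set u) = ((2 * side u) ^+ n * height u)%:E.
Proof.
move: gamma_ge0 gamma_alpha alpha_lt1 => g0 ga a1.
move=> vu; have [u0 _ _] := vu; have h0 := height_gt0 vu.
by rewrite lebesgue_half_open_tube ?(ltW u0)//; [congr EFin; ring|lra].
Qed.

Lemma lebesgue_cell_set_ge u : valid_cell u ->
  (((1 - alpha) / 2 * cell_measure u)%:E <= mu (cell_set u))%E.
Proof.
move: gamma_ge0 gamma_alpha alpha_lt1 => g0 ga a1.
move=> vu; have [u0 hl _] := vu; rewrite lebesgue_cell_set// lee_fin /cell_measure.
rewrite mulrCA ler_wpM2l ?exprn_ge0 ?mulr_ge0 ?(ltW u0)//; lra.
Qed.

Lemma lebesgue_lower u : 0 < side u ->
  mu (lower u) = ((1 - gamma) * cell_measure u)%:E.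
Proof.
move: gamma_ge0 gamma_alpha alpha_lt1 => g0 ga a1.
move=> u0; have e0 : 0 < side u `^ p by rewrite powR_gt0.
rewrite lebesgue_tube ?(ltW u0)//; first by congr EFin; rewrite /cell_measure; ring.
have : 0 <= (1 - gamma) * side u `^ p by rewrite mulr_ge0 ?ltW//; lra.
lra.
Qed.

Lemma cell_measure_child u v : valid_cell u -> v \in children u ->
  cell_measure u = N%:R ^+ n * N%:R `^ p * cell_measure v.
Proof.
move=> [u0 _ _] /childrenP[k [j ->]].
rewrite /cell_measure (_ : side (child _ _ _) = side u / N%:R)//.
rewrite (side_powR u0); set w := side u / N%:R.
have -> : side u = N%:R * w by rewrite mulrCA divff ?mulr1// gt_eqF.
have -> : (2 * (N%:R * w)) ^+ n = N%:R ^+ n * (2 * w) ^+ n by rewrite mulrCA exprMn.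
by rewrite -!mulrA; congr (_ * _); rewrite [LHS]mulrA [LHS]mulrC.
Qed.


(** * Comparison of the constants of a cell and its children *)

Variables (D : set (spacetime R n)) (f : spacetime R n -> R) (c : cell R n -> R)
  (K delta : R).
Hypotheses (K_ge0 : 0 <= K) (delta_gt0 : 0 < delta)
  (delta_child : delta * (1 + N%:R ^+ n * N%:R `^ p) < 1 - gamma)
  (delta_cover : 20 * 3 ^+ n * delta <= (1 - alpha) * (1 - gamma - delta)).
Hypothesis upper_small : forall u, 0 < side u -> whole u `<=` D ->
  (mu (upper u `&` [set z | (c u + K < f z)%R]) <= (delta * cell_measure u)%:E)%E.
Hypothesis lower_small : forall u, 0 < side u -> whole u `<=` D ->
  (mu (lower u `&` [set z | (f z < c u - K)%R]) <= (delta * cell_measure u)%:E)%E.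

(** Outside its exceptional set, [lower v] satisfies f >= c v - K > c u + K, and the exceptional set
    takes only [delta] out of the proportion 1 - gamma. *)
Lemma lower_jump u v : 0 < side v -> whole v `<=` D -> lower v `<=` upper u ->
  c u + 2 * K < c v ->
  (((1 - gamma - delta) * cell_measure v)%:E <=
   mu ([set z | (c u + K < f z)%R] `&` lower v))%E.
Proof.
move=> v0 vD vu cuv.
have H : (((1 - gamma) * cell_measure v)%:E <=
    (delta * cell_measure v)%:E + mu ([set z | (c u + K < f z)%R] `&` lower v))%E.
  rewrite -lebesgue_lower//.
  apply: le_trans (leeD (lower_small v0 vD) (lexx _)).
  apply: le_trans (outer_measureU2 _ _ _); apply: le_outer_measure => z lz.
  have [fz|fz] := ltP (f z) (c v - K); first by left.
  by right; split => //=; lra.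
have -> : (1 - gamma - delta) * cell_measure v =
    (1 - gamma) * cell_measure v - delta * cell_measure v by ring.
by rewrite EFinB leeBlDl.
Qed.

(** A larger jump would, by [lower_jump], put too much of [lower v] into the exceptional set of
    [upper u]: the latter has measure at most delta * N ^ n * N ^ p * cell_measure v, which
    [delta_child] makes smaller than (1 - gamma - delta) * cell_measure v. *)
Lemma child_constant_le u v : valid_cell u -> whole u `<=` D -> v \in children u ->
  c v <= c u + 2 * K.
Proof.
move=> vu uD uv; have [u0 _ _] := vu.
have [v0 _ _] : valid_cell v.
  by move: uv => /childrenP[k [j ->]]; exact: child_valid.
have vsub := whole_child_sub vu uv.
have vD : whole v `<=` D.
  by move=> z /vsub /(upper_sub_whole u0); exact: uD.
rewrite leNgt; apply/negP => cuv.
have lvu : lower v `<=` upper u by move=> z /(lower_sub_whole v0)/vsub.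
have := lower_jump v0 vD lvu cuv; rewrite leNgt => /negP; apply.
apply: le_lt_trans (_ : _ <= (delta * cell_measure u)%:E)%E _.
  apply: le_trans (upper_small u0 uD); rewrite setIC.
  by apply: le_outer_measure; exact: setSI.
rewrite lte_fin (cell_measure_child vu uv) mulrA ltr_pM2r ?cell_measure_gt0//.
by move: delta_child; lra.
Qed.

(** * Selection of the stopped cells and their total measure *)

Section stopping.
Variable u0 : cell R n.
Hypotheses (u0_valid : valid_cell u0) (u0D : whole u0 `<=` D).

Definition selected v := c u0 + 2 * K < c v.

Fixpoint unselected (d : nat) : seq (cell R n) :=
  if d is d'.+1 then
    [seq v <- flatten [seq children u | u <- unselected d'] | ~~ selected v]
  else [:: u0].

(** The index [d] is the generation of the parents, so these cells belong to generation d + 1. They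
    are the first selected cells on their branches. *)
Definition newly_selected (d : nat) : seq (cell R n) :=
  [seq v <- flatten [seq children u | u <- unselected d] | selected v].

Lemma unselectedP d v : v \in unselected d -> [/\ valid_cell v,
  upper v `<=` upper u0, whole v `<=` D, c v <= c u0 + 2 * K &
  side v = side u0 / N%:R ^+ d].
Proof.
elim: d v => [|d IH] v.
  rewrite inE => /eqP ->; split => //; last by rewrite expr0 divr1.
  by move: K_ge0; lra.
rewrite mem_filter -leNgt => /andP[cv /flatten_mapP[u ud uv]].
have [vu uu0 uD _ su] := IH _ ud; have [u00 _ _] := vu.
have wvu := whole_child_sub vu uv.
have vv : valid_cell v.
  by move: uv => /childrenP[k [j ->]]; exact: child_valid.
have [v0 _ _] := vv; split => //.
- by move=> z /(upper_sub_whole v0)/wvu/uu0.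
- by move=> z /wvu/(upper_sub_whole u00)/uD.
- by move: uv => /childrenP[k [j ->]]; rewrite exprSr invfM mulrA -su.
Qed.

Lemma newly_selectedP d v : v \in newly_selected d -> [/\ valid_cell v,
  whole v `<=` upper u0, whole v `<=` D, c u0 + 2 * K < c v &
  c v <= c u0 + 4 * K].
Proof.
rewrite mem_filter => /andP[cv /flatten_mapP[u ud uv]].
have [vu uu0 uD cu su] := unselectedP ud; have [u00 _ _] := vu.
have wvu := whole_child_sub vu uv.
have vv : valid_cell v.
  by move: uv => /childrenP[k [j ->]]; exact: child_valid.
split => //.
- by move=> z /wvu/uu0.
- by move=> z /wvu/(upper_sub_whole u00)/uD.
- by apply: le_trans (child_constant_le vu uD uv) _; lra.
Qed.

(** In each generation, the parts of [F] in the children of an unselected cell add up to at most its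
    part in that cell; the children are then sorted into selected and unselected ones. *)
Lemma selection_packing m (F : set (spacetime R n)) :
  (\sum_(0 <= d < m) \sum_(v <- newly_selected d) mu (F `&` cell_set v)
   + \sum_(v <- unselected m) mu (F `&` cell_set v) <= mu (F `&` cell_set u0))%E.
Proof.
elim: m => [|m IH]; first by rewrite big_nil add0e /= big_seq1.
apply: le_trans IH; rewrite big_nat_recr//= -addeA leeD2l//.
rewrite !big_filter; set kids := flatten _.
have <- : (\sum_(v <- kids) mu (F `&` cell_set v) =
    \sum_(v <- kids | selected v) mu (F `&` cell_set v) +
    \sum_(v <- kids | ~~ selected v) mu (F `&` cell_set v))%E by rewrite (bigID selected).
rewrite big_flatten big_map big_seq [leRHS]big_seq.
apply: lee_sum => u /unselectedP[vu _ _ _ _].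
exact: sum_children_le.
Qed.

Lemma selection_cover m z : cell_set u0 z ->
  (exists2 d, (d < m)%N & exists2 v, v \in newly_selected d & cell_set v z) \/
  (exists2 v, v \in unselected m & cell_set v z).
Proof.
move=> u0z; elim: m => [|m [[d dm [v vd vz]]|[u um uz]]].
- by right; exists u0; rewrite //= inE.
- by left; exists d; [exact: leqW|exists v].
have [vu _ _ _ _] := unselectedP um.
have [v uv vz] := cell_set_child vu uz.
have vk : v \in flatten [seq children u | u <- unselected m].
  by apply/flatten_mapP; exists u.
have [sv|nsv] := boolP (selected v).
  by left; exists m => //; exists v => //; rewrite mem_filter sv.
by right; exists v => //=; rewrite mem_filter nsv.
Qed.

Let engulf v := half_open_tube (center v) (3 * side v)
  (top v - 3 * side v `^ p) (top v + 2 * side v `^ p).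

(** In space, three distances of at most [side v] add up. In time, the cell of [w] lies between top
    v - 2 * side v ^ p and top v + side v ^ p, well inside the interval of [engulf v]. The lower
    parts are compared because [lower_jump] gives information on them. *)
Lemma cell_set_sub_engulf v w : valid_cell w -> 0 < side v -> side w <= side v ->
  lower w `&` lower v !=set0 -> cell_set w `<=` engulf v.
Proof.
move: gamma_ge0 gamma_alpha alpha_lt1 p1 => g0 ga a1 p1'.
move=> vw v0 wv [z [[zxw /andP[zw1 zw2]] [zxv /andP[zv1 zv2]]]] y [yx /andP[y1 y2]].
have [w0 _ hw] := vw.
have le : side w `^ p <= side v `^ p.
  by rewrite ge0_ler_powR ?nnegrE ?(ltW w0) ?(ltW v0)//; lra.
have e0 : 0 < side w `^ p by rewrite powR_gt0.
have hw' : height w <= side w `^ p.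
  by apply: le_trans hw _; rewrite ler_piMl ?(ltW e0)//; lra.
have ge0 : 0 <= gamma * side v `^ p by rewrite mulr_ge0 ?powR_ge0.
have gw0 : 0 <= gamma * side w `^ p by rewrite mulr_ge0 ?powR_ge0.
split => [i|].
  have := zxw i; have := zxv i; have := yx i; rewrite !ler_distl.
  by move=> /andP[? ?] /andP[? ?] /andP[? ?]; apply/andP; split; lra.
by apply/andP; split; lra.
Qed.

Lemma lebesgue_engulf v : 0 < side v ->
  mu (engulf v) = (5 * 3 ^+ n * cell_measure v)%:E.
Proof.
move=> v0; have e0 : 0 < side v `^ p by rewrite powR_gt0.
rewrite lebesgue_half_open_tube ?mulr_ge0 ?(ltW v0)//; last lra.
congr EFin; rewrite /cell_measure.
have -> : (2 * (3 * side v)) ^+ n = 3 ^+ n * (2 * side v) ^+ n by rewrite mulrCA exprMn.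
by ring.
Qed.

Lemma lower_neq0 v : valid_cell v -> lower v !=set0.
Proof.
move: gamma_ge0 gamma_alpha alpha_lt1 p1 => g0 ga a1 p1'.
move=> [v0 _ _]; have e0 : 0 < (1 - gamma) * side v `^ p.
  by rewrite mulr_gt0 ?powR_gt0//; lra.
exists (center v, top v - (3 + gamma) / 2 * side v `^ p); split => /= [i|].
  by rewrite subrr normr0 ltW.
by apply/andP; split; lra.
Qed.

Lemma selected_measure_le m :
  (\sum_(0 <= d < m) \sum_(v <- newly_selected d) mu (cell_set v)
   <= (2^-1)%:E * mu (cell_set u0))%E.
Proof.
move: gamma_ge0 gamma_alpha alpha_lt1 p1 => g0 ga a1 p1'.
have [u00 hu0 _] := u0_valid.
pose s := flatten [seq newly_selected d | d <- index_iota 0 m].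
have sP v : v \in s -> exists d, v \in newly_selected d.
  by move=> /flatten_mapP[d _ vd]; exists d.
have sumE (F : cell R n -> \bar R) :
    (\sum_(0 <= d < m) \sum_(v <- newly_selected d) F v = \sum_(v <- s) F v)%E.
  by rewrite big_flatten big_map.
have lower0 v : v \in s -> lower v !=set0.
  by move=> /sP[d /newly_selectedP[vv _ _ _ _]]; exact: lower_neq0.
have [t [ut ts dt ht]] := greedy_disjoint_subfamily side lower0.
(* Each selected cell lies in [engulf v] for some kept [v], hence in [W], so that packing with test
   set [W] bounds the total by the measure of [W]. *)
pose W := \bigcup_(v in [set` t]) engulf v.
have -> : (\sum_(0 <= d < m) \sum_(v <- newly_selected d) mu (cell_set v) =
    \sum_(0 <= d < m) \sum_(v <- newly_selected d) mu (W `&` cell_set v))%E.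
  rewrite !sumE big_seq [RHS]big_seq; apply: eq_bigr => w ws; congr (mu _).
  apply/esym/setIidr => z wz; have [v vt [wv lwv]] := ht _ ws; exists v => //.
  have [_ /newly_selectedP[vw _ _ _ _]] := sP _ ws.
  have [_ /newly_selectedP[[v0 _ _] _ _ _ _]] := sP _ (ts _ vt).
  exact: (cell_set_sub_engulf vw v0 wv lwv).
have t0 v : v \in t -> 0 < side v.
  by move=> /ts/sP[_ /newly_selectedP[[]]].
apply: (@le_trans _ _ (\sum_(v <- t) mu (engulf v))%E).
  apply: (@le_trans _ _ (mu W)); last first.
    by apply: outer_measure_le_sum => z [v vt vz]; exists v.
  apply: le_trans (le_outer_measure mu _ _ (@subIsetl _ W (cell_set u0))).
  apply: le_trans (selection_packing m W).
  by rewrite leeDl// sume_ge0// => v _; exact: outer_measure_ge0.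
(* The kept lower parts are disjoint subsets of [upper u0], and by [lower_jump] each contributes to
   the exceptional set of [u0]. *)
have cover : (\sum_(v <- t) ((1 - gamma - delta) * cell_measure v)%:E <=
    (delta * cell_measure u0)%:E)%E.
  apply: le_trans (upper_small u00 u0D); rewrite setIC.
  apply: le_trans (outer_measure_sum_disjoint (A := lower) _ ut _ dt _).
  - rewrite big_seq [leRHS]big_seq; apply: lee_sum => v vt.
    have [_ /newly_selectedP[[v0 _ _] vu0 vD cv _]] := sP _ (ts _ vt).
    apply: lower_jump => //; exact: subset_trans (lower_sub_whole v0) vu0.
  - by move=> v _; exact: caratheodory_tube.
  - move=> v vt; have [_ /newly_selectedP[[v0 _ _] vu0 vD cv _]] := sP _ (ts _ vt).
    exact: subset_trans (lower_sub_whole v0) vu0.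
move: cover; rewrite sumEFin lee_fin -mulr_sumr => cover.
rewrite big_seq (eq_bigr (fun v => (5 * 3 ^+ n * cell_measure v)%:E)); last first.
  by move=> v /t0; exact: lebesgue_engulf.
rewrite -big_seq sumEFin -mulr_sumr.
apply: le_trans (lee_wpmul2l _ (lebesgue_cell_set_ge u0_valid)) => //.
rewrite -EFinM lee_fin; move: cover (cell_measure_gt0 u00).
move: (\sum_(v <- t) _) (cell_measure u0) => S M cover M0.
move: delta_gt0 delta_cover cover; set e := 1 - gamma - delta => d0 dc cover.
have e0 : 0 < e.
  rewrite -(pmulr_rgt0 _ (_ : 0 < 1 - alpha)) ?subr_gt0//.
  by apply: lt_le_trans dc; rewrite !mulr_gt0 ?exprn_gt0.
(* The 20 in [delta_cover] is 5 * 2 * 2: the time enlargement of [engulf], the factor 1 / 2 in the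
   lower bound for the measure of [cell_set u0], and the desired half. *)
rewrite -(ler_pM2l e0).
have h1 : 20 * 3 ^+ n * (e * S) <= 20 * 3 ^+ n * (delta * M).
  by rewrite ler_wpM2l// mulr_ge0// exprn_ge0.
have h2 : 20 * 3 ^+ n * delta * M <= (1 - alpha) * e * M.
  by rewrite ler_wpM2r// ltW.
by clearbody e; lra.
Qed.

(** * The high level outside the stopped cells is null *)

Let level := [set z | (c u0 + 3 * K < f z)%R].

(** As c v <= c u0 + 2 * K, the level set lies in the exceptional set of [v], and [delta_cover]
    gives delta <= (1 - alpha) / 4. Any proportion below 1 would serve for [remainder_null]. *)
Lemma unselected_level_le d v : v \in unselected d ->
  (mu (cell_set v `&` level) <= (2^-1)%:E * mu (cell_set v))%E.
Proof.
move: gamma_ge0 gamma_alpha alpha_lt1 delta_gt0 => g0 ga a1 d0.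
move=> /unselectedP[vv _ vD cv _]; have [v0 _ _] := vv.
apply: (@le_trans _ _ (delta * cell_measure v)%:E).
  apply: le_trans (upper_small v0 vD); apply: le_outer_measure.
  by move=> z [/(cell_set_sub_upper vv) vz fz]; split => //=; move: fz;
    rewrite /level /=; lra.
apply: le_trans (lee_wpmul2l _ (lebesgue_cell_set_ge vv)) => //.
rewrite -EFinM lee_fin; move: (cell_measure v) (cell_measure_gt0 v0) => M M0.
rewrite mulrA ler_pM2r//.
have : 1 * delta <= 3 ^+ n * delta by rewrite ler_pM2r// exprn_ege1// ler1n.
have : (1 - alpha) * (1 - gamma - delta) <= (1 - alpha) * 1.
  by rewrite ler_wpM2l//; lra.
by move: delta_cover; lra.
Qed.

Let remainder := (cell_set u0 `&` level) `\`
  \bigcup_d \bigcup_(v in [set` newly_selected d]) cell_set v.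

Lemma remainder_sub d z : remainder z -> exists2 v, v \in unselected d & cell_set v z.
Proof.
move=> [[u0z _] nz]; have [[d' _ [v vd' vz]]|//] := selection_cover d u0z.
by exfalso; apply: nz; exists d' => //; exists v.
Qed.

Definition enlarge_box (e : R) (a b : spacetime R n) : spacetime R n * spacetime R n :=
  ((\row_i (a.1 0 i - e), a.2 - e), (\row_i (b.1 0 i + e), b.2 + e)).

Lemma cell_set_sub_enlarge v (e : R) a b : valid_cell v -> 2 * side v <= e ->
  side v <= 1 -> cell_set v `&` box a b !=set0 ->
  cell_set v `<=` box (enlarge_box e a b).1 (enlarge_box e a b).2.
Proof.
move: gamma_ge0 gamma_alpha alpha_lt1 p1 => g0 ga a1 p1'.
move=> [v0 _ hv] ve v1 [y [[yx /andP[y1 y2]] [ya /andP[yb1 yb2]]]] z [zx /andP[z1 z2]].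
have hv' : height v <= side v.
  apply: le_trans hv _; apply: le_trans (_ : side v `^ p <= _).
    by rewrite ler_piMl ?powR_ge0//; lra.
  by apply: ge1r_powR; rewrite ?v0// ltW.
split => /= [i|]; last by apply/andP; split; lra.
have := yx i; have := zx i; have := ya i; rewrite !mxE.
by move=> /andP[? ?] /andP[? ?] /andP[? ?]; apply/andP; split; lra.
Qed.

Lemma unselected_side_small (e : R) : 0 < e ->
  exists d, forall v, v \in unselected d -> 2 * side v <= e.
Proof.
move=> e0; have [u00 _ _] := u0_valid.
have y0 : 0 <= 2 * side u0 / e by rewrite !mulr_ge0 ?invr_ge0// ltW.
have /andP[_ lt] := truncn_itv y0; set d := (Num.truncn _).+1 in lt.
exists d => v /unselectedP[_ _ _ _ ->].
rewrite mulrA ler_pdivrMr ?exprn_gt0// [e * _]mulrC -ler_pdivrMr//.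
apply: le_trans (ltW lt) _; apply: le_trans (_ : (2 ^ d)%:R <= _).
  by rewrite ler_nat ltnW// ltn_expl.
by rewrite natrX lerXn2r// ?nnegrE// ltW.
Qed.

(** Unselected cells of a late generation cover the remainder, and those meeting the box stay in the
    enlarged box. The level set fills at most half of each, and packing adds up their measures. *)
Lemma remainder_box_le (e : R) a b : 0 < e ->
  (mu (remainder `&` box a b) <=
   (2^-1 * box_volume (enlarge_box e a b).1 (enlarge_box e a b).2)%:E)%E.
Proof.
(* The bound 1 ensures side ^ p <= side, so that the heights of the cells are small together with
   their sides. *)
move=> e0; have m0 : 0 < Num.min e 1 by rewrite lt_min e0/=.
have [d hd] := unselected_side_small m0.
pose s := [seq v <- unselected d | `[< cell_set v `&` box a b !=set0 >]].
set B := box (enlarge_box e a b).1 (enlarge_box e a b).2.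
apply: (@le_trans _ _ (\sum_(v <- s) mu (cell_set v `&` level))%E).
  apply: outer_measure_le_sum => z [Gz Bz].
  have [v vd vz] := remainder_sub d Gz.
  exists v; last by split => //; case: Gz => -[].
  by rewrite mem_filter vd andbT; apply/asboolP; exists z.
apply: (@le_trans _ _ (\sum_(v <- s) (2^-1)%:E * mu (B `&` cell_set v))%E).
  rewrite big_seq [leRHS]big_seq; apply: lee_sum => v.
  rewrite mem_filter => /andP[/asboolP vB vd].
  have [vv _ _ _ _] := unselectedP vd.
  have := hd _ vd; rewrite le_min => /andP[ve v1].
  rewrite [B `&` _]setIidr; first exact: unselected_level_le vd.
  apply: cell_set_sub_enlarge => //.
  by have [v0 _ _] := vv; apply: le_trans v1; lra.
rewrite -ge0_sume_distrr => [|v _]; last exact: outer_measure_ge0.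
rewrite EFinM; apply: lee_wpmul2l => //.
apply: (@le_trans _ _ (mu (B `&` cell_set u0))); last first.
  by apply: lebesgue_outer_box_le; exact: subIsetl.
apply: le_trans (selection_packing d B).
apply: (@le_trans _ _ (\sum_(v <- unselected d) mu (B `&` cell_set v))%E).
  rewrite big_filter [leRHS](bigID (fun v => `[< cell_set v `&` box a b !=set0 >]))/=.
  by rewrite leeDl// sume_ge0// => v _; exact: outer_measure_ge0.
rewrite leeDr// sume_ge0// => j _; apply: sume_ge0 => v _; exact: outer_measure_ge0.
Qed.

Lemma enlarge_box_volume_cvg a b :
  box_volume (enlarge_box e a b).1 (enlarge_box e a b).2 @[e --> 0^'+] --> box_volume a b.
Proof.
have maxc (x y : R) : Num.max 0 (y + e - (x - e)) @[e --> 0^'+] --> Num.max 0 (y - x).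
  have h : Num.max 0 (y + e - (x - e)) @[e --> (0 : R)] -->
      Num.max 0 (y + 0 - (x - 0)).
    apply: (@continuous_max _ _ (fun=> 0) (fun e : R => y + e - (x - e)) 0).
      exact: cst_continuous.
    apply: cvgB; apply: cvgD; try exact: cvg_cst; try exact: cvg_id.
    by apply: cvgN; exact: cvg_id.
  rewrite addr0 subr0 in h.
  exact: cvg_at_right_filter.
rewrite /box_volume /=; apply: cvgM; last exact: maxc.
have := @cvg_big R 'I_n *%R 1 xpredT (@mul_continuous R) R 0^'+ (index_enum 'I_n)
  (fun i e => Num.max 0 ((enlarge_box e a b).2.1 0 i - (enlarge_box e a b).1.1 0 i))
  (fun i => Num.max 0 (b.1 0 i - a.1 0 i)) _.
apply => i _; rewrite /enlarge_box /=.
by under eq_cvg => e do rewrite !mxE; exact: maxc.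
Qed.

(* Letting the mesh tend to 0 replaces Lebesgue's density theorem. *)
Lemma remainder_half a b :
  (mu (remainder `&` box a b) <= (2^-1 * box_volume a b)%:E)%E.
Proof.
have fin : mu (remainder `&` box a b) \is a fin_num.
  rewrite ge0_fin_numE ?outer_measure_ge0//.
  apply: (@le_lt_trans _ _ (box_volume a b)%:E); last exact: ltry.
  by apply: lebesgue_outer_box_le; exact: subIsetr.
rewrite -(fineK fin) lee_fin.
have h : 2^-1 * box_volume (enlarge_box e a b).1 (enlarge_box e a b).2
    @[e --> 0^'+] --> 2^-1 * box_volume a b.
  by apply: cvgM; [exact: cvg_cst|exact: enlarge_box_volume_cvg].
rewrite -(cvg_lim _ h)//; apply: limr_ge; first exact: cvgP h.
near=> e; rewrite -lee_fin fineK//; apply: remainder_box_le.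
by near: e; exact: nbhs_right_gt.
Unshelve. all: by end_near. Qed.

(** Summing [remainder_half] over an arbitrary cover shows that the measure is at most half of
    itself, and it is finite. *)
Lemma remainder_null : mu remainder = 0%E.
Proof.
have fin : mu remainder \is a fin_num.
  rewrite ge0_fin_numE ?outer_measure_ge0//.
  apply: (@le_lt_trans _ _ (mu (cell_set u0))); last by rewrite lebesgue_cell_set// ltry.
  by apply: le_outer_measure => z [[]].
have : (2%:E * mu remainder <= mu remainder)%E.
  apply: le_ereal_inf_tmp => _ [B RB <-].
  have half :
      (mu remainder <= \sum_(k <oo) (2^-1)%:E * (box_volume (B k).1 (B k).2)%:E)%E.
    apply: (@le_trans _ _ (\sum_(k <oo) mu (remainder `&` box (B k).1 (B k).2))%E).
      apply: le_trans (outer_measure_sigma_subadditive mu _).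
      apply: le_outer_measure => z Rz; have [k _ Bz] := RB _ Rz.
      by exists k.
    apply: lee_nneseries => [k _ _|k _]; first exact: outer_measure_ge0.
    by rewrite -EFinM; exact: remainder_half.
  rewrite nneseriesZl in half; last by move=> k _; rewrite lee_fin box_volume_ge0.
  apply: le_trans (lee_wpmul2l _ half) _ => //.
  by rewrite muleA -EFinM divff// mul1e.
rewrite -(fineK fin) -EFinM lee_fin => h; congr EFin.
have : 0 <= fine (mu remainder) by rewrite fine_ge0// outer_measure_ge0.
by lra.
Qed.

(** Up to the null remainder, the set lies in the stopped cells. There c v <= c u0 + 4 * K, so the
    assumed decay applies at height [A] above c v, and the stopped cells fill at most half of
    [u0]. *)
Lemma level_decay (A : R) (r : R) : 0 <= A -> 0 <= r ->
  (forall v, valid_cell v -> whole v `<=` D ->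
    (mu (cell_set v `&` [set z | (c v + A < f z)%R]) <= r%:E * mu (cell_set v))%E) ->
  (mu (cell_set u0 `&` [set z | (c u0 + 4 * K + A < f z)%R]) <=
    (r / 2)%:E * mu (cell_set u0))%E.
Proof.
move=> A0 r0 IH.
set E := _ `&` _.
pose sel d := \bigcup_(v in [set` newly_selected d]) cell_set v.
have Esub : E `<=` remainder `|` \bigcup_d (E `&` sel d).
  move=> z [u0z fz]; have [[d _ sz]|nz] := pselect ((\bigcup_d sel d) z).
    by right; exists d => //; split.
  by left; split => //; split => //; move: K_ge0 fz; rewrite /level /=; lra.
apply: le_trans (le_outer_measure mu _ _ Esub) _.
apply: le_trans (outer_measureU2 _ _ _) _; rewrite [X in (X + _)%E]remainder_null add0e.
apply: le_trans (outer_measure_sigma_subadditive mu _) _.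
apply: lime_le.
  by apply: is_cvg_nneseries => k _ _; exact: outer_measure_ge0.
near=> m.
apply: (@le_trans _ _ (\sum_(0 <= d < m)
    \sum_(v <- newly_selected d) r%:E * mu (cell_set v))%E).
  apply: lee_sum => d _.
  apply: (@le_trans _ _ (\sum_(v <- newly_selected d)
      mu (cell_set v `&` [set z | (c v + A < f z)%R]))%E).
    apply: outer_measure_le_sum => z [[_ fz] [v vd vz]]; exists v => //; split => //.
    by have [_ _ _ _ cv] := newly_selectedP vd; move: fz => /=; lra.
  rewrite big_seq [leRHS]big_seq; apply: lee_sum => v /newly_selectedP[vv _ vD _ _].
  exact: IH.
rewrite EFinM -muleA.
apply: le_trans (lee_wpmul2l _ (selected_measure_le m)); last by rewrite lee_fin.
rewrite ge0_sume_distrr => [|d _]; last first.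
  by apply: sume_ge0 => v _; exact: outer_measure_ge0.
by apply: lee_sum => d _; rewrite ge0_sume_distrr// => v _; exact: outer_measure_ge0.
Unshelve. all: by end_near. Qed.

End stopping.

Lemma cell_decay (j : nat) u : valid_cell u -> whole u `<=` D ->
  (mu (cell_set u `&` [set z | (c u + 4 * K * j%:R < f z)%R]) <=
    (2^-1 ^+ j)%:E * mu (cell_set u))%E.
Proof.
elim: j u => [|j IH] u vu uD.
  by rewrite expr0 mul1e; apply: le_outer_measure => z [].
have Kj : 0 <= 4 * K * j%:R by rewrite !mulr_ge0.
rewrite exprSr; have := level_decay vu uD Kj _ IH.
rewrite (_ : c u + 4 * K + 4 * K * j%:R = c u + 4 * K * j.+1%:R); first by apply.
by rewrite -natr1; ring.
Qed.

End cells.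

(** * Parabolic rectangles *)

Section parabolic_rectangles.
Context (R : realType) (n : nat).
Implicit Types (x : 'rV[R]_n) (p g t L : R).
Local Notation mu := (@lebesgue_outer R n).

Lemma prectE p x t L : prect p x t L = tube x L (t - L `^ p) (t + L `^ p).
Proof.
by apply/seteqP; split => z [zx zt]; split => //; move: zt; rewrite /= in_itv.
Qed.

Lemma prect_upE p g x t L :
  prect_up p g x t L = tube x L (t + g * L `^ p) (t + L `^ p).
Proof.
by apply/seteqP; split => z [zx zt]; split => //; move: zt; rewrite /= in_itv.
Qed.

Lemma prect_lowE p g x t L :
  prect_low p g x t L = tube x L (t - L `^ p) (t - g * L `^ p).
Proof.
by apply/seteqP; split => z [zx zt]; split => //; move: zt; rewrite /= in_itv.
Qed.

Lemma lebesgue_prect_up p g x t L : 0 < L -> g < 1 ->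
  mu (prect_up p g x t L) = ((1 - g) * ((2 * L) ^+ n * L `^ p))%:E.
Proof.
move=> L0 g1; have e0 : 0 < (1 - g) * L `^ p by rewrite mulr_gt0 ?powR_gt0 ?subr_gt0.
rewrite prect_upE lebesgue_tube ?(ltW L0)//; last lra.
by congr EFin; ring.
Qed.

Lemma lebesgue_prect_low p g x t L : 0 < L -> g < 1 ->
  mu (prect_low p g x t L) = ((1 - g) * ((2 * L) ^+ n * L `^ p))%:E.
Proof.
move=> L0 g1; have e0 : 0 < (1 - g) * L `^ p by rewrite mulr_gt0 ?powR_gt0 ?subr_gt0.
rewrite prect_lowE lebesgue_tube ?(ltW L0)//; last lra.
by congr EFin; ring.
Qed.

(** * Reflection in time *)

Definition reflect_time (z : spacetime R n) : spacetime R n := (z.1, - z.2).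

Lemma reflect_timeK : involutive reflect_time.
Proof. by move=> [y s]; rewrite /reflect_time /= opprK. Qed.

Lemma lebesgue_outer_reflect (E : set (spacetime R n)) :
  mu (reflect_time @^-1` E) = mu E.
Proof.
suff le (F : set (spacetime R n)) : (mu (reflect_time @^-1` F) <= mu F)%E.
  apply/eqP; rewrite eq_le le/=; apply: le_trans (le _).
  by apply: le_outer_measure => z /=; rewrite /preimage /= reflect_timeK.
apply: le_ereal_inf_tmp => _ [B FB <-].
pose C k := ((B k).1.1, - (B k).2.2, ((B k).2.1, - (B k).1.2)).
rewrite (_ : (fun k => _) = (fun k => (\sum_(0 <= j < k)
    (box_volume (C j).1 (C j).2)%:E)%E)).
  apply: (@lebesgue_outer_cover_le _ _ _ C) => z /FB[k _ [Bx /= Bt]].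
  by exists k => //; split => //=; move: Bt => /andP[? ?]; apply/andP; split; lra.
apply/funext => k; apply: eq_bigr => j _; congr EFin.
by rewrite /box_volume /=; congr (_ * Num.max _ _); lra.
Qed.

End parabolic_rectangles.

(* The first bound on [delta] compares the constants of a cell and of its
   children, the second one drives the covering argument. *)
Lemma good_parameters (R : realType) (n : nat) (p gamma alpha : R) :
  0 <= gamma -> gamma < alpha -> alpha < 1 ->
  exists (N : nat) (delta : R), [/\ 2 <= (alpha - gamma) * N%:R, 0 < delta,
    delta * (1 + N%:R ^+ n * N%:R `^ p) < 1 - gamma &
    20 * 3 ^+ n * delta <= (1 - alpha) * (1 - gamma - delta)].
Proof.
move=> g0 ga a1.
have y0 : 0 <= 2 / (alpha - gamma) by rewrite divr_ge0 ?subr_ge0 ?ltW.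
(* This [N] exceeds 2 / (alpha - gamma). *)
have /andP[_ lt] := truncn_itv y0; set N := (Num.truncn _).+1 in lt.
exists N; set q := N%:R ^+ n * N%:R `^ p.
have q0 : 0 <= q by rewrite mulr_ge0 ?exprn_ge0 ?powR_ge0.
have t0 : 0 <= 20 * 3 ^+ n :> R by rewrite mulr_ge0 ?exprn_ge0.
set M := 20 * 3 ^+ n + 1 + q.
have M0 : 0 < M by rewrite /M; lra.
(* Both bounds on [delta] have a total coefficient of at most [M] once the terms in [delta] are
   collected, and delta * M is half of (1 - alpha) * (1 - gamma). *)
exists ((1 - alpha) * (1 - gamma) / M / 2).
set d := (1 - alpha) * (1 - gamma) / M / 2.
have dM : d * M = (1 - alpha) * (1 - gamma) / 2.
  by rewrite /d mulrAC divfK ?gt_eqF.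
have d0 : 0 < d by rewrite !divr_gt0// mulr_gt0; lra.
have ag0 : 0 < (1 - alpha) * (1 - gamma) by rewrite mulr_gt0; lra.
have ag1 : (1 - alpha) * (1 - gamma) <= 1 - gamma by rewrite ler_piMl//; lra.
have da : (1 - alpha) * d <= d by rewrite ler_piMl ?(ltW d0)//; lra.
have td : 0 <= 20 * 3 ^+ n * d by rewrite mulr_ge0// ltW.
have qd : 0 <= q * d by rewrite mulr_ge0// ltW.
move: dM; rewrite /M => dM; split => //.
- by move: lt; rewrite ltr_pdivrMr ?subr_gt0// => lt; lra.
- by clearbody d q; lra.
- by clearbody d q; lra.
Qed.

(** The upper part with parameter [alpha] is, up to its boundary, the cell with final time t + L ^ p
    and height (1 - alpha) * L ^ p, so [cell_decay] applies to it. *)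
Lemma prect_up_decay (R : realType) (n : nat) (p gamma alpha : R) :
  1 < p -> 0 <= gamma -> gamma < alpha -> alpha < 1 ->
  exists2 delta : R, 0 < delta &
  forall (D : set (spacetime R n)) (f : spacetime R n -> R)
    (c : 'rV[R]_n -> R -> R -> R) (K : R), 0 <= K ->
  (forall (x : 'rV[R]_n) (t L : R), 0 < L -> prect p x t L `<=` D ->
    (lebesgue_outer (prect_up p gamma x t L `&` [set z | (c x t L + K < f z)%R])
      <= (delta * ((2 * L) ^+ n * L `^ p))%:E)%E) ->
  (forall (x : 'rV[R]_n) (t L : R), 0 < L -> prect p x t L `<=` D ->
    (lebesgue_outer (prect_low p gamma x t L `&` [set z | (f z < c x t L - K)%R])
      <= (delta * ((2 * L) ^+ n * L `^ p))%:E)%E) ->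
  forall (x : 'rV[R]_n) (t L : R), 0 < L -> prect p x t L `<=` D -> forall j : nat,
    (lebesgue_outer
      (prect_up p alpha x t L `&` [set z | (c x t L + 4 * K * j%:R < f z)%R])
     <= (2^-1 ^+ j)%:E * lebesgue_outer (prect_up p alpha x t L))%E.
Proof.
move=> p1 g0 ga a1.
have [N [delta [NL d0 dchild dcover]]] := good_parameters n p g0 ga a1.
exists delta => // D f c K K0 up low x t L L0 PD j.
(* The rectangle of a cell is centered at time top u - side u ^ p. *)
pose c' (u : cell R n) := c (center u) (top u - side u `^ p) (side u).
have wholeE (u : cell R n) :
    whole p u = prect p (center u) (top u - side u `^ p) (side u).
  by rewrite prectE /whole; congr (tube _ _ _ _); ring.
have upperE (u : cell R n) :
    upper p gamma u = prect_up p gamma (center u) (top u - side u `^ p) (side u).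
  by rewrite prect_upE /upper; congr (tube _ _ _ _); ring.
have lowerE (u : cell R n) :
    lower p gamma u = prect_low p gamma (center u) (top u - side u `^ p) (side u).
  by rewrite prect_lowE /lower; congr (tube _ _ _ _); ring.
have up' (u : cell R n) : 0 < side u -> whole p u `<=` D ->
    (lebesgue_outer (upper p gamma u `&` [set z | (c' u + K < f z)%R])
      <= (delta * cell_measure p u)%:E)%E.
  by rewrite wholeE upperE => u0 uD; exact: up.
have low' (u : cell R n) : 0 < side u -> whole p u `<=` D ->
    (lebesgue_outer (lower p gamma u `&` [set z | (f z < c' u - K)%R])
      <= (delta * cell_measure p u)%:E)%E.
  by rewrite wholeE lowerE => u0 uD; exact: low.
pose u : cell R n := (x, t + L `^ p, L, (1 - alpha) * L `^ p).
have e0 : 0 < (1 - alpha) * L `^ p by rewrite mulr_gt0 ?powR_gt0// subr_gt0.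
have vu : valid_cell p alpha u.
  by split; rewrite /side /height//=; lra.
have uD : whole p u `<=` D by rewrite wholeE /center /top /side/= addrK.
have := cell_decay p1 g0 ga a1 NL K0 d0 dchild dcover up' low' j vu uD.
have -> : c' u = c x t L by rewrite /c' /center /top /side/= addrK.
have mE : lebesgue_outer (prect_up p alpha x t L) = lebesgue_outer (cell_set u).
  rewrite lebesgue_prect_up// (lebesgue_cell_set g0 ga a1 vu)//; congr EFin.
  by rewrite /side /height /=; ring.
(* Intersecting with the cell preserves the finite measure, so the Carathéodory identity leaves
   measure 0 for the rest. *)
have boundary : lebesgue_outer (prect_up p alpha x t L `&` ~` cell_set u) = 0%E.
  have : lebesgue_outer (prect_up p alpha x t L `&` cell_set u) =
      lebesgue_outer (prect_up p alpha x t L).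
    rewrite mE lebesgue_half_open_tube ?(ltW L0)//; last first.
      by rewrite /top /height/=; lra.
    apply: (@lebesgue_outer_tube _ _ x); rewrite ?(ltW L0)//.
    - by rewrite /top /height/=; lra.
    - move=> z zx zt; split.
        rewrite prect_upE; split => [i|]; first by rewrite ltW.
        by move: zt; rewrite /top /height/= => /andP[? ?]; apply/andP; split; lra.
      split => [i|]; last by move: zt => /andP[? ?]; apply/andP; split; lra.
      by have := zx i; rewrite ltr_distl => /andP[/ltW -> ->].
    - move=> z [_ [zx /andP[z1 z2]]]; split => [i|]; last by rewrite z1 ltW.
      by have /andP[h1 h2] := zx i; rewrite ler_distl h1 ltW.
  have := caratheodory_cell_set u (prect_up p alpha x t L).
  move=> E1 E2; rewrite E2 (lebesgue_prect_up _ _ _ L0 a1) in E1.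
  by move: E1; case: (lebesgue_outer (_ `&` ~` _)) => [r||]//= [?]; congr EFin; lra.
rewrite mE; apply: le_trans.
apply: le_trans (le_outer_measure (@lebesgue_outer R n) _
  (cell_set u `&` [set z | (c x t L + 4 * K * j%:R < f z)%R] `|`
   prect_up p alpha x t L `&` ~` cell_set u) _) _.
  move=> z [Pz fz]; have [uz|uz] := pselect (cell_set u z); first by left.
  by right.
apply: le_trans (outer_measureU2 _ _ _) _.
by rewrite [X in (_ + X)%E]boundary adde0.
Qed.

(* Reversing time and changing the sign of [f] exchanges the upper and the lower
   parts, and keeps the constants up to sign. *)
Lemma prect_decay (R : realType) (n : nat) (p gamma alpha : R) :
  1 < p -> 0 <= gamma -> gamma < alpha -> alpha < 1 ->
  exists2 delta : R, 0 < delta &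
  forall (D : set (spacetime R n)) (f : spacetime R n -> R)
    (c : 'rV[R]_n -> R -> R -> R) (K : R), 0 <= K ->
  (forall (x : 'rV[R]_n) (t L : R), 0 < L -> prect p x t L `<=` D ->
    (lebesgue_outer (prect_up p gamma x t L `&` [set z | (c x t L + K < f z)%R])
      <= (delta * ((2 * L) ^+ n * L `^ p))%:E)%E) ->
  (forall (x : 'rV[R]_n) (t L : R), 0 < L -> prect p x t L `<=` D ->
    (lebesgue_outer (prect_low p gamma x t L `&` [set z | (f z < c x t L - K)%R])
      <= (delta * ((2 * L) ^+ n * L `^ p))%:E)%E) ->
  forall (x : 'rV[R]_n) (t L : R), 0 < L -> prect p x t L `<=` D -> forall j : nat,
    (lebesgue_outer
      (prect_up p alpha x t L `&` [set z | (c x t L + 4 * K * j%:R < f z)%R])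
     <= (2^-1 ^+ j)%:E * lebesgue_outer (prect_up p alpha x t L))%E /\
    (lebesgue_outer
      (prect_low p alpha x t L `&` [set z | (f z < c x t L - 4 * K * j%:R)%R])
     <= (2^-1 ^+ j)%:E * lebesgue_outer (prect_low p alpha x t L))%E.
Proof.
move=> p1 g0 ga a1.
have [delta d0 decay] := @prect_up_decay R n p gamma alpha p1 g0 ga a1.
exists delta => // D f c K K0 up low x t L L0 PD j.
split; first exact: (decay D).
have lowE g (y : 'rV[R]_n) (s r : R) :
    prect_low p g y s r = @reflect_time R n @^-1` prect_up p g y (- s) r.
  rewrite prect_lowE prect_upE; apply/seteqP.
  by split=> z [zx /andP[z1 z2]]; split => //=; apply/andP; split;
     move: z1 z2; rewrite /=; lra.
have upE g (y : 'rV[R]_n) (s r : R) :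
    prect_up p g y s r = @reflect_time R n @^-1` prect_low p g y (- s) r.
  rewrite prect_lowE prect_upE; apply/seteqP.
  by split=> z [zx /andP[z1 z2]]; split => //=; apply/andP; split;
     move: z1 z2; rewrite /=; lra.
have prectN (y : 'rV[R]_n) (s r : R) :
    prect p y s r = @reflect_time R n @^-1` prect p y (- s) r.
  rewrite !prectE; apply/seteqP.
  by split=> z [zx /andP[z1 z2]]; split => //=; apply/andP; split;
     move: z1 z2; rewrite /=; lra.
pose f' z := - f (reflect_time z); pose c' (y : 'rV[R]_n) s r := - c y (- s) r.
have sub (y : 'rV[R]_n) (s r : R) : prect p y s r `<=` @reflect_time R n @^-1` D ->
    prect p y (- s) r `<=` D.
  rewrite prectN => h z Pz; have := h (reflect_time z).
  by rewrite /preimage /= reflect_timeK; exact.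
have := decay (@reflect_time R n @^-1` D) f' c' K K0 _ _ x (- t) L L0 _ j.
rewrite lowE lebesgue_outer_reflect => H.
apply: le_trans (H _ _ _).
- rewrite -[leRHS]lebesgue_outer_reflect; apply: le_outer_measure => z [Pz fz].
  split => //=; rewrite /f' /c' opprK reflect_timeK; move: fz => /=; lra.
- move=> y s r r0 /sub PD'.
  apply: le_trans (low y (- s) r r0 PD').
  rewrite -[leRHS]lebesgue_outer_reflect; apply: le_outer_measure => z [Pz fz].
  split; first by move: Pz; rewrite upE.
  by move: fz; rewrite /f' /c' /=; lra.
- move=> y s r r0 /sub PD'.
  apply: le_trans (up y (- s) r r0 PD').
  rewrite -[leRHS]lebesgue_outer_reflect; apply: le_outer_measure => z [Pz fz].
  split; first by move: Pz; rewrite lowE.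
  by move: fz; rewrite /f' /c' /=; lra.
- move=> z; rewrite prectN opprK => Pz; exact: PD.
Qed.

(** * From oscillation to level sets *)

Lemma markov_power d (T : measurableType d) (R : realType)
    (mu : {measure set T -> \bar R}) (E : set T) (g : T -> R) (q K : R) :
  0 < q -> 0 < K -> measurable E -> measurable_fun E g -> (forall z, 0 <= g z) ->
  ((K `^ q)%:E * mu (E `&` [set z | (K < g z)%R])
    <= \int[mu]_(z in E) (g z `^ q)%:E)%E.
Proof.
move=> q0 K0 mE mg g0.
have mS : measurable (E `&` [set z | (K < g z)%R]).
  rewrite (_ : [set z | _] = g @^-1` `]K, +oo[); first exact: mg.
  by apply/seteqP; split => z; rewrite /= in_itv/= andbT.
have mgq : measurable_fun E (fun z => (g z `^ q)%:E).
  by apply/measurable_EFinP; exact: (measurableT_comp (measurable_powR _)).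
rewrite -integral_cst//.
apply: (@le_trans _ _ (\int[mu]_(z in E `&` [set z | (K < g z)%R]) (g z `^ q)%:E)%E).
  apply: ge0_le_integral => //.
  - by move=> z _; rewrite lee_fin powR_ge0.
  - exact: measurable_funS mgq.
  - move=> z [_ /= Kg]; rewrite lee_fin ge0_ler_powR ?nnegrE ?(ltW q0) ?(ltW K0)//.
    exact: ltW.
apply: ge0_subset_integral => //.
by move=> z _; rewrite lee_fin powR_ge0.
Qed.

Lemma average_level_le (R : realType) (n : nat) (E : set (spacetime R n))
    (g : spacetime R n -> R) (q K M m : R) :
  0 < q -> 0 < K -> 0 < m ->
  measurable (E : set (lebesgue_space R n)) ->
  measurable_fun (E : set (lebesgue_space R n)) g -> (forall z, 0 <= g z) ->
  lebesgue E = m%:E -> (average E (fun z => g z `^ q)%R <= M%:E)%E ->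
  ((K `^ q)%:E * lebesgue (E `&` [set z | (K < g z)%R]) <= (m * M)%:E)%E.
Proof.
move=> q0 K0 m0 mE mg g0 Em; rewrite /average Em inver gt_eqF// => av.
apply: le_trans (markov_power (@lebesgue R n) q0 K0 mE mg g0) _.
have := lee_wpmul2l (_ : 0 <= m%:E)%E av.
rewrite muleA -!EFinM divff ?gt_eqF// mul1e; apply.
by rewrite lee_fin ltW.
Qed.

Lemma poweR_inv_le (R : realType) (q M : R) (y1 y2 : \bar R) : 0 < q -> 0 <= M ->
  (0 <= y1)%E -> (0 <= y2)%E -> ((y1 + y2) `^ q^-1 <= M%:E)%E ->
  (y1 <= (M `^ q)%:E)%E /\ (y2 <= (M `^ q)%:E)%E.
Proof.
move=> q0 M0 y1_ge0 y2_ge0 yM.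
suff le : (y1 + y2 <= (M `^ q)%:E)%E.
  by split; apply: le_trans le; [rewrite leeDl|rewrite leeDr].
have -> : (y1 + y2 = ((y1 + y2) `^ q^-1) `^ q)%E.
  by rewrite -poweRrM mulVf ?gt_eqF// poweRe1// adde_ge0.
rewrite -poweR_EFin; apply: gt0_ler_poweR (ltW q0) _ _ _ _ yM.
  by rewrite in_itv/= poweR_ge0 leey.
by rewrite in_itv/= lee_fin M0 leey.
Qed.

(** Here the exponential decay is weakened to the claimed form: rounding down costs the factor 2,
    and y ^ q <= 1 + y costs the factor exp(b). *)
Lemma expR_floor_bound (R : realType) (b y q : R) : 0 < b -> 0 <= y -> 0 < q <= 1 ->
  2^-1 ^+ Num.truncn (b * y / ln 2) <= 2 * expR b * expR (- (b * y `^ q)) :> R.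
Proof.
move=> b0 y0 /andP[q0 q1].
have l0 : 0 < ln 2 :> R by rewrite ln_gt0// ltr1n.
have t0 : 0 <= b * y / ln 2 by apply: divr_ge0; [apply: mulr_ge0 => //|]; exact: ltW.
have /andP[_ lt] := truncn_itv t0; set j := Num.truncn _ in lt *.
have yq : y `^ q <= 1 + y.
  have [y1|y1] := leP 1 y; first by apply: le_trans (ler1_powR y1 q1) _; lra.
  apply: le_trans (_ : 1 `^ q <= _); last by rewrite powR1; lra.
  by rewrite ge0_ler_powR ?nnegrE ?(ltW q0) ?(ltW y1)//.
have -> : 2^-1 ^+ j = 2 * expR (- (j.+1%:R * ln 2)) :> R.
  rewrite -mulrN expRM_natl expRN lnK ?posrE// exprS mulrA divff ?mul1r//.
rewrite -mulrA ler_pM2l// -expRD ler_expR.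
move: lt; rewrite ltr_pdivrMr// => lt.
have : b * y `^ q <= b * (1 + y) by rewrite ler_pM2l.
by lra.
Qed.

Lemma lt_funrpos (R : realType) (T : Type) (f : T -> R) (c K : R) (z : T) : 0 <= K ->
  (K < (f \- cst c)^\+ z) = (c + K < f z).
Proof.
move=> K0; rewrite /funrpos /= lt_max [K < 0]ltNge K0 orbF.
by rewrite ltrBrDl.
Qed.

Lemma lt_funrneg (R : realType) (T : Type) (f : T -> R) (c K : R) (z : T) : 0 <= K ->
  (K < (f \- cst c)^\- z) = (f z < c - K).
Proof.
move=> K0; rewrite /funrneg /= lt_max [K < 0]ltNge K0 orbF /= opprB.
by rewrite !ltrBrDl addrC -ltrBrDr addrC.
Qed.

Section oscillation.
Context (R : realType) (n : nat) (p q gamma : R) (D : set (spacetime R n))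
  (f : spacetime R n -> R).

(** Both averages are nonnegative, so each is at most M ^ q, and Chebyshev's inequality applies to
    each part separately. *)
Lemma pbmo_osc_level_le (M K c t L : R) (x : 'rV[R]_n) :
  0 < q -> 0 <= gamma -> gamma < 1 -> 0 <= M -> 0 < K -> 0 < L ->
  measurable_fun (prect p x t L : set (lebesgue_space R n)) f ->
  (pbmo_osc p q gamma f x t L c <= M%:E)%E ->
  ((K `^ q)%:E * lebesgue_outer (prect_up p gamma x t L `&` [set z | (c + K < f z)%R])
    <= ((1 - gamma) * ((2 * L) ^+ n * L `^ p) * M `^ q)%:E)%E /\
  ((K `^ q)%:E * lebesgue_outer (prect_low p gamma x t L `&` [set z | (f z < c - K)%R])
    <= ((1 - gamma) * ((2 * L) ^+ n * L `^ p) * M `^ q)%:E)%E.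
Proof.
move=> q0 g0 g1 M0 K0 L0 mf osc.
have e0 : 0 < L `^ p by rewrite powR_gt0.
have gL : 0 <= gamma * L `^ p by rewrite mulr_ge0 ?powR_ge0.
have upS : prect_up p gamma x t L `<=` prect p x t L.
  rewrite prectE prect_upE => z [zx /andP[z1 z2]]; split => //.
  by apply/andP; split; lra.
have lowS : prect_low p gamma x t L `<=` prect p x t L.
  rewrite prectE prect_lowE => z [zx /andP[z1 z2]]; split => //.
  by apply/andP; split; lra.
have mD : measurable (prect p x t L : set (lebesgue_space R n)).
  by rewrite prectE; exact: caratheodory_tube.
have mup : measurable (prect_up p gamma x t L : set (lebesgue_space R n)).
  by rewrite prect_upE; exact: caratheodory_tube.
have mlow : measurable (prect_low p gamma x t L : set (lebesgue_space R n)).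
  by rewrite prect_lowE; exact: caratheodory_tube.
have mfc : measurable_fun (prect p x t L : set (lebesgue_space R n)) (f \- cst c).
  exact: measurable_funB.
have m0 : 0 < (1 - gamma) * ((2 * L) ^+ n * L `^ p).
  by rewrite mulr_gt0 ?subr_gt0// mulr_gt0// exprn_gt0// mulr_gt0.
have av0 (E : set (spacetime R n)) (h : spacetime R n -> R) m :
    0 < m -> lebesgue E = m%:E -> (0 <= average E (fun z => h z `^ q)%R)%E.
  move=> m_gt0 Em; rewrite /average Em inver gt_eqF// mule_ge0//.
    by rewrite lee_fin invr_ge0 ltW.
  by apply: integral_ge0 => z _; rewrite lee_fin powR_ge0.
have avup := av0 _ (f \- cst c)^\+ _ m0 (lebesgue_prect_up p x t L0 g1).
have avlow := av0 _ (f \- cst c)^\- _ m0 (lebesgue_prect_low p x t L0 g1).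
have [ub lb] := poweR_inv_le q0 M0 avup avlow osc.
split.
- rewrite (_ : [set z | _] = [set z | K < (f \- cst c)^\+ z]); last first.
    by apply/seteqP; split => z /=; rewrite lt_funrpos// ltW.
  apply: (average_level_le q0 K0 m0 mup _ _ (lebesgue_prect_up p x t L0 g1) ub).
  + by apply: measurable_funS mD upS _; exact: measurable_funrpos.
  + by move=> z; exact: funrpos_ge0.
- rewrite (_ : [set z | _] = [set z | K < (f \- cst c)^\- z]); last first.
    by apply/seteqP; split => z /=; rewrite lt_funrneg// ltW.
  apply: (average_level_le q0 K0 m0 mlow _ _ (lebesgue_prect_low p x t L0 g1) lb).
  + by apply: measurable_funS mD lowS _; exact: measurable_funrneg.
  + by move=> z; exact: funrneg_ge0.
Qed.

End oscillation.

(** * Choice of the constants and conclusion *)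

Unset Implicit Arguments.

Theorem corollary3p2 (R : realType) (n : nat) (p q gamma alpha : R)
    (hn : (1 <= n)%N) (hp : 1 < p) (hgamma : 0 <= gamma < 1)
    (halpha : gamma < alpha < 1) (hq : 0 < q <= 1) :
  exists A B : R, 0 < A /\ 0 < B /\
    forall (x : 'rV[R]_n) (t L : R) (f : spacetime R n -> R),
      0 < L ->
      pbmo p q gamma (prect p x t L) f ->
      (0 < pbmo_norm p q gamma (prect p x t L) f)%E ->
      let N := fine (pbmo_norm p q gamma (prect p x t L) f) in
      exists c : R, forall lambda : R, 0 < lambda ->
        (lebesgue (prect_up p alpha x t L `&`
                   [set z | (lambda < (f \- cst c)^\+ z)%R])
         <= (A * expR (- (B * (lambda / N) `^ q)))%:E
            * lebesgue (prect_up p alpha x t L))%E /\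
        (lebesgue (prect_low p alpha x t L `&`
                   [set z | (lambda < (f \- cst c)^\- z)%R])
         <= (A * expR (- (B * (lambda / N) `^ q)))%:E
            * lebesgue (prect_low p alpha x t L))%E.
Proof.
move: hgamma halpha (hq) => /andP[g0 g1] /andP[ga a1] /andP[q0 q1].
have [delta d0 decay] := @prect_decay R n p gamma alpha hp g0 ga a1.
(* With K = kappa * N one has (2 * N) ^ q = K ^ q * delta, so Chebyshev's inequality yields the
   proportion [delta]. The 2 allows for constants that are only nearly optimal. *)
pose kappa := 2 / delta `^ q^-1.
have k0 : 0 < kappa by rewrite divr_gt0// powR_gt0.
have l0 : 0 < ln 2 :> R by rewrite ln_gt0// ltr1n.
(* Chosen so that b * (lambda / N) / ln 2 = lambda / (4 * K), the number of steps of height 4 * K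
   below lambda. *)
pose b := ln 2 / (4 * kappa).
have b0 : 0 < b by rewrite divr_gt0// mulr_gt0.
exists (2 * expR b), b; split; first by rewrite mulr_gt0// expR_gt0.
split => // x t L f L0 [[mf _] finN] N0 N.
set D := prect p x t L in mf finN N0 N *.
have NE : pbmo_norm p q gamma D f = N%:E.
  by rewrite /N fineK// ge0_fin_numE// ltW.
have N_gt0 : 0 < N by rewrite -lte_fin -NE.
clearbody N.
(* The infimum over constants need not be attained, but it is at most N < 2 * N. Triples that give
   no rectangle inside [D] receive the default 0. *)
have /choice[c0 hc0] : forall w : 'rV[R]_n * R * R, exists c : R,
    0 < w.2 -> prect p w.1.1 w.1.2 w.2 `<=` D ->
    (pbmo_osc p q gamma f w.1.1 w.1.2 w.2 c <= (2 * N)%:E)%E.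
  move=> [[y s] r] /=.
  have [[r0 PD]|nr] := pselect (0 < r /\ prect p y s r `<=` D); last first.
    by exists 0 => r0 PD; exfalso; apply: nr.
  have le : (ereal_inf [set pbmo_osc p q gamma f y s r c | c in [set: R]]
      < (2 * N)%:E)%E.
    apply: (@le_lt_trans _ _ N%:E); last by rewrite lte_fin; lra.
    by rewrite -NE; apply: ereal_sup_ubound; exists y, s, r; split.
  have [_ [c _ <-] lt] := ereal_inf_lt le.
  by exists c => _ _; exact: ltW.
pose c y s r := c0 (y, s, r).
pose K := kappa * N.
have K0 : 0 < K by rewrite mulr_gt0.
have Kq : (2 * N) `^ q = K `^ q * delta.
  rewrite [in RHS](_ : delta = (delta `^ q^-1) `^ q); last first.
    by rewrite -powRrM mulVf ?gt_eqF// powRr1// ltW.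
  rewrite -powRM ?powR_ge0 ?(ltW K0)//; congr (_ `^ _).
  by rewrite /K /kappa mulrAC divfK// gt_eqF// powR_gt0.
have small (y : 'rV[R]_n) (s r : R) (X : set (spacetime R n)) : 0 < r ->
    ((K `^ q)%:E * lebesgue_outer X
       <= ((1 - gamma) * ((2 * r) ^+ n * r `^ p) * (2 * N) `^ q)%:E)%E ->
    (lebesgue_outer X <= (delta * ((2 * r) ^+ n * r `^ p))%:E)%E.
  move=> r0; have Kq0 : 0 < K `^ q by rewrite powR_gt0.
  rewrite Kq => h.
  have v0 : 0 <= (2 * r) ^+ n * r `^ p.
    by rewrite mulr_ge0 ?powR_ge0// exprn_ge0// mulr_ge0// ltW.
  rewrite -(@lee_pmul2l _ (K `^ q)%:E) ?lte_fin//.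
  apply: le_trans h _; rewrite -EFinM lee_fin.
  set v := _ * _ in v0 *; rewrite (_ : (1 - gamma) * v * (K `^ q * delta) =
    (1 - gamma) * (K `^ q * (delta * v))); last by ring.
  have Kv : 0 <= K `^ q * (delta * v).
    by apply: mulr_ge0; [exact: ltW|apply: mulr_ge0 => //; exact: ltW].
  by rewrite ler_piMl//; lra.
have mD : measurable (D : set (lebesgue_space R n)).
  by rewrite /D prectE; exact: caratheodory_tube.
have mfP (y : 'rV[R]_n) (s r : R) : prect p y s r `<=` D ->
    measurable_fun (prect p y s r : set (lebesgue_space R n)) f.
  by move=> PD; apply: measurable_funS mD PD mf.
have osc (y : 'rV[R]_n) (s r : R) (r0 : 0 < r) (PD : prect p y s r `<=` D) :=
  @pbmo_osc_level_le R n p q gamma f (2 * N) K (c y s r) s r y q0 g0 g1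
    (mulr_ge0 (ler0n _ 2) (ltW N_gt0)) K0 r0
    (mfP y s r PD) (hc0 (y, s, r) r0 PD).
have dec := decay D f c K (ltW K0) _ _ x t L L0 (@subset_refl _ D).
exists (c x t L) => lambda lam0.
set j := Num.truncn (b * (lambda / N) / ln 2).
have jle : 4 * K * j%:R <= lambda.
  have t0 : 0 <= b * (lambda / N) / ln 2.
    by apply: divr_ge0; [apply: mulr_ge0; [|apply: divr_ge0]|]; exact: ltW.
  have /andP[le _] := truncn_itv t0; rewrite -/j in le.
  have -> : lambda = 4 * K * (b * (lambda / N) / ln 2).
    by rewrite /K /b; field; rewrite !gt_eqF.
  by rewrite ler_pM2l// mulr_gt0.
have [||up low] := dec _ _ j.
- by move=> y s r r0 PD; apply: small => //; have [] := osc y s r r0 PD.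
- by move=> y s r r0 PD; apply: small => //; have [] := osc y s r r0 PD.
have y0 : 0 <= lambda / N by rewrite divr_ge0 ?ltW.
have jbound := expR_floor_bound b0 y0 hq; rewrite -/j in jbound.
split.
- apply: le_trans (lee_wpmul2r (outer_measure_ge0 _ _) (_ : (2^-1 ^+ j)%:E <= _)%E).
    apply: le_trans up; apply: le_outer_measure => z [Pz] /=.
    rewrite (lt_funrpos _ _ _ (ltW lam0)) => fz; split; first exact: Pz.
    by apply: le_lt_trans fz; rewrite lerD2l.
  by rewrite lee_fin.
- apply: le_trans (lee_wpmul2r (outer_measure_ge0 _ _) (_ : (2^-1 ^+ j)%:E <= _)%E).
    apply: le_trans low; apply: le_outer_measure => z [Pz] /=.
    rewrite (lt_funrneg _ _ _ (ltW lam0)) => fz; split; first exact: Pz.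
    by apply: lt_le_trans fz _; rewrite lerD2l lerN2.
  by rewrite lee_fin.
Qed.
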